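(* The algorithm $\mathcal A$ described in the context is a fully polynomial almost uniform sampler for proper colorings with bias parameter $\delta$ on graphs of pathwidth $O(\log n)$. That is: (i) for every graph $G$ with $n$ vertices and maximal degree $\Delta\ge 1$, every integer $k\ge\Delta+2$ and every $\delta\in(0,1)$, the output of $\mathcal A$ on input $(G,k,\delta)$ is a random proper $k$-coloring of $G$ whose distribution $D$ satisfies $d_{TV}(D,U)\le\delta$, where $U$ is the uniform distribution on the proper $k$-colorings of $G$; (ii) for any fixed constants $\epsilon>0$ and $C>0$, on inputs with $k=(1+\epsilon)\Delta\ge\Delta+2$ and $\mathrm{pw}(G)\le C\log n$, the algorithm $\mathcal A$ runs in time polynomial in $n$ and $\log(1/\delta)$.
   Context: Graphs are finite, simple and undirected; $\mathrm{pw}(G)$ is the pathwidth of $G$. A $k$-coloring of $G=(V,E)$ is any map $\sigma:V\to[k]=\{1,\dots,k\}$; an edge $(u,v)\in E$ is monochromatic if $\sigma(u)=\sigma(v)$. The coloring is proper if it has no monochromatic edge; it is singly-flawed if it has at least one monochromatic edge and some vertex is contained in all monochromatic edges. The Single-Flaw dynamics with $k$ colors on $G$ is the Markov chain whose state space $\Omega$ is the set of all proper and all singly-flawed $k$-colorings of $G$, with transitions from $\sigma\in\Omega$: with probability $1/2$ stay at $\sigma$; otherwise choose $v\in V$ and $c\in[k]$ independently and uniformly at random, and let $\sigma'$ be $\sigma$ with the color of $v$ replaced by $c$; move to $\sigma'$ if $\sigma'\in\Omega$, and stay at $\sigma$ otherwise. Its stationary distribution $\pi$ is uniform on $\Omega$.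 With $P$ the transition matrix and $d_{TV}(\mu,\nu)=\max_{S\subseteq\Omega}|\mu(S)-\nu(S)|$, let $\tau_\sigma(\delta)=\min\{\bar t: d_{TV}(P^t(\sigma,\cdot),\pi)\le\delta\text{ for all }t\ge\bar t\}$ and $\tau(\delta)=\max_{\sigma\in\Omega}\tau_\sigma(\delta)$. Algorithm $\mathcal A$, on input $G$, $k\ge\Delta+2$, $\delta$: set $\delta_1=\delta/(kn+1)^2$ and $T=\lceil\ln(3/\delta)(kn+2)^2\rceil$. For $t=1,\dots,T$: simulate (with fresh randomness) the Single-Flaw dynamics with $k$ colors on $G$ for $\tau(\delta_1)$ steps starting from an arbitrary proper $k$-coloring; if the final state $\sigma$ is a proper coloring, return $\sigma$ and halt. If the loop ends without returning, return an arbitrary proper $k$-coloring. The number $\tau(\delta_1)$ is regarded as known to the algorithm. (Proper $k$-colorings exist and can be found greedily since $k\ge\Delta+2$.) *)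

(* Defs.v *)
From HB Require Import structures.
From mathcomp Require Import all_boot all_order all_algebra.
From mathcomp Require Import all_classical all_reals all_analysis.

Set Implicit Arguments.
Unset Strict Implicit.
Unset Printing Implicit Defensive.

Import Order.TTheory GRing.Theory Num.Theory.
Local Open Scope ring_scope.

(* The value 0 for the empty set is a convention. *)
Definition nat_min (P : nat -> Prop) : nat :=
  xget 0%N [set m | P m /\ forall j, P j -> (m <= j)%N]%classic.

Record sgraph := SGraph {
  vertex :> finType;
  edge : rel vertex;
  edge_sym : symmetric edge;
  edge_irrefl : irreflexive edge }.

Section Graph.
Variable G : sgraph.

Definition max_degree : nat := \max_(v : G) #|[set w | edge v w]|.

Definition path_decomposition (bags : seq {set G}) : Prop :=
  [/\ forall v : G, exists2 X, X \in bags & v \in X,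
      forall u v : G, edge u v -> exists2 X, X \in bags & (u \in X) && (v \in X)
    & forall i j l : nat, (i <= j)%N -> (j <= l)%N -> (l < size bags)%N ->
        nth finset.set0 bags i :&: nth finset.set0 bags l \subset nth finset.set0 bags j].

Definition width (bags : seq {set G}) : nat := (\max_(X <- bags) #|X|).-1.

Definition pathwidth : nat :=
  nat_min (fun w => exists2 bags, path_decomposition bags & width bags = w).

Variable k : nat.

Definition coloring := {ffun G -> 'I_k}.
HB.instance Definition _ := Finite.on coloring.

Definition recolor (s : coloring) (v : G) (c : 'I_k) : coloring :=
  [ffun w => if w == v then c else s w].

Definition monochromatic (s : coloring) (u v : G) : bool :=
  edge u v && (s u == s v).

Definition proper_coloring (s : coloring) : bool :=
  [forall u, forall v, ~~ monochromatic s u v].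

Definition singly_flawed (s : coloring) : bool :=
  [exists u, exists v, monochromatic s u v] &&
  [exists x, forall u, forall v,
     monochromatic s u v ==> (x == u) || (x == v)].

Definition Omega : predArgType :=
  {s : coloring | proper_coloring s || singly_flawed s}.

(* [insubd s x] is [x] when [x] lies in [Omega], and [s] otherwise. *)
Definition next_state (s : Omega) (v : G) (c : 'I_k) : Omega :=
  insubd s (recolor (val s) v c).

End Graph.

Definition dTV (R : realType) (T : finType) (mu nu : T -> R) : R :=
  \big[Num.max/0]_(S : {set T}) `|\sum_(x in S) mu x - \sum_(x in S) nu x|.

Definition uniform (R : realType) (T : finType) (A : pred T) (x : T) : R :=
  if A x then #|A|%:R^-1 else 0.

Section SingleFlaw.
Variables (R : realType) (G : sgraph) (k : nat).
Local Notation states := (Omega G k).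

Definition transition_prob (s s' : states) : R :=
  2^-1 * (s == s')%:R +
  2^-1 * (\sum_(v : G) \sum_(c < k)
            (#|G| * k)%:R^-1 * (next_state s v c == s')%:R).

Definition transition_matrix : 'M[R]_#|{: states}| :=
  \matrix_(i, j) transition_prob (enum_val i) (enum_val j).

Definition law_after (t : nat) (s s' : states) : R :=
  (transition_matrix ^+ t) (enum_rank s) (enum_rank s').

Definition mixing_time_from (delta : R) (s : states) : nat :=
  nat_min (fun t0 => forall t, (t0 <= t)%N ->
             dTV (law_after t s) (uniform R predT) <= delta).

Definition mixing_time (delta : R) : nat :=
  \max_(s : states) mixing_time_from delta s.

End SingleFlaw.

(* The memory of a program is one array holding a color for each vertex.  The
   graph is accessed by adjacency queries.  [Tick] accounts for an elementary
   operation on machine words or numbers (a comparison, a loop counter). *)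
Inductive prog (G : sgraph) (k : nat) (A : Type) : Type :=
| Ret of A
| Tick of prog G k A
| Flip of (bool -> prog G k A)
| DrawVertex of (G -> prog G k A)
| DrawColor of ('I_k -> prog G k A)
| Adjacent of G & G & (bool -> prog G k A)
| Read of G & ('I_k -> prog G k A)
| Write of G & 'I_k & prog G k A.

Arguments Ret {G k A}.
Arguments Tick {G k A}.
Arguments Flip {G k A}.
Arguments DrawVertex {G k A}.
Arguments DrawColor {G k A}.
Arguments Adjacent {G k A}.
Arguments Read {G k A}.
Arguments Write {G k A}.

Section Semantics.
Variables (G : sgraph) (k : nat).

(* Probability that [p], run from memory [s], halts with memory [s']. *)
Fixpoint final_prob (R : realType) A (p : prog G k A) (s s' : coloring G k)
    : R :=
  match p with
  | Ret _ => (s == s')%:R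
  | Tick q => final_prob R q s s'
  | Flip q => \sum_(b : bool) 2^-1 * final_prob R (q b) s s'
  | DrawVertex q => \sum_(v : G) #|G|%:R^-1 * final_prob R (q v) s s'
  | DrawColor q => \sum_(c < k) k%:R^-1 * final_prob R (q c) s s'
  | Adjacent u v q => final_prob R (q (edge u v)) s s'
  | Read v q => final_prob R (q (s v)) s s'
  | Write v c q => final_prob R q (recolor s v c) s'
  end.

(* Number of operations, in the worst case over the random draws. *)
Fixpoint time A (p : prog G k A) (s : coloring G k) : nat :=
  match p with
  | Ret _ => 0
  | Tick q => (time q s).+1
  | Flip q => (\max_(b : bool) time (q b) s).+1
  | DrawVertex q => (\max_(v : G) time (q v) s).+1
  | DrawColor q => (\max_(c < k) time (q c) s).+1
  | Adjacent u v q => (time (q (edge u v)) s).+1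
  | Read v q => (time (q (s v)) s).+1
  | Write v c q => (time q (recolor s v c)).+1
  end%N.

Fixpoint bind A B (p : prog G k A) (f : A -> prog G k B) : prog G k B :=
  match p with
  | Ret a => f a
  | Tick q => Tick (bind q f)
  | Flip q => Flip (fun b => bind (q b) f)
  | DrawVertex q => DrawVertex (fun v => bind (q v) f)
  | DrawColor q => DrawColor (fun c => bind (q c) f)
  | Adjacent u v q => Adjacent u v (fun b => bind (q b) f)
  | Read v q => Read v (fun c => bind (q c) f)
  | Write v c q => Write v c (bind q f)
  end.

End Semantics.

Notation "'let!' x := p 'in' q" := (bind p (fun x => q))
  (at level 200, x name, p at level 100, q at level 200).
Notation "'do!' p 'then' q" := (bind p (fun _ : unit => q))
  (at level 200, p at level 100, q at level 200).

Section Operations.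
Variables (G : sgraph) (k : nat).
Local Notation prog := (prog G k).

Definition flip : prog bool := Flip Ret.
Definition draw_vertex : prog G := DrawVertex Ret.
Definition draw_color : prog 'I_k := DrawColor Ret.
Definition adjacent (u v : G) : prog bool := Adjacent u v Ret.
Definition read (v : G) : prog 'I_k := Read v Ret.
Definition write (v : G) (c : 'I_k) : prog unit := Write v c (Ret tt).
(* Evaluates, at unit cost, an expression of bounded size; in [sampler] this
   includes the real arithmetic of the two formulas. *)
Definition compute A (a : A) : prog A := Tick (Ret a).

Fixpoint all_in A (test : A -> prog bool) (r : seq A) : prog bool :=
  if r is x :: r' then
    Tick (let! b := test x in if b then all_in test r' else Ret false)
  else Ret true.

Fixpoint first_in A (test : A -> prog bool) (r : seq A) : prog (option A) :=
  if r is x :: r' then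
    Tick (let! b := test x in if b then Ret (Some x) else first_in test r')
  else Ret None.

Fixpoint repeat (m : nat) (p : prog unit) : prog unit :=
  if m is m'.+1 then Tick (do! p then repeat m' p) else Ret tt.

End Operations.

Section Algorithm.
Variables (G : sgraph) (k : nat).
Local Notation prog := (prog G k).

Definition monochromatic_prog (u v : G) : prog bool :=
  let! a := adjacent k u v in
  let! cu := read k u in
  let! cv := read k v in
  compute _ _ (a && (cu == cv)).

Definition proper_prog : prog bool :=
  all_in (fun u =>
    all_in (fun v =>
      let! m := monochromatic_prog u v in compute _ _ (~~ m))
    (enum G)) (enum G).

Definition flaw_prog : prog bool :=
  let! x := first_in (fun x =>
    all_in (fun u =>
      all_in (fun v =>
        let! m := monochromatic_prog u v in
        compute _ _ (m ==> (x == u) || (x == v)))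
      (enum G)) (enum G)) (enum G) in
  compute _ _ (isSome x).

(* [flaw_prog] only tests that some vertex lies on all monochromatic edges; the
   failed [proper_prog] has shown that there is one. *)
Definition in_Omega_prog : prog bool :=
  let! b := proper_prog in if b then Ret true else flaw_prog.

Definition single_flaw_step : prog unit :=
  let! stay := flip G k in
  if stay then Ret tt else
  let! v := draw_vertex G k in
  let! c := draw_color G k in
  let! old := read k v in
  do! write v c then
  let! ok := in_Omega_prog in
  if ok then Ret tt else write v old.

Definition conflict_free (v : G) (colored : seq G) (c : 'I_k) : prog bool :=
  all_in (fun u =>
    let! a := adjacent k u v in
    let! cu := read k u in
    compute _ _ (~~ (a && (cu == c)))) colored.

Fixpoint greedy_from (colored todo : seq G) : prog unit :=
  if todo is v :: todo' then
    Tick (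
      let! oc := first_in (conflict_free v colored) (enum 'I_k) in
      do! (if oc is Some c then write v c else Ret tt) then
      greedy_from (v :: colored) todo')
  else Ret tt.

Definition greedy : prog unit := greedy_from [::] (enum G).

(* [start] is a subroutine which, whatever the contents of the array, replaces
   them by some proper coloring. *)
Definition finds_proper (R : realType) (start : prog unit) : Prop :=
  forall s s', final_prob R start s s' != 0 -> proper_coloring s'.

Fixpoint attempts (start : prog unit) (tau T : nat) : prog unit :=
  if T is T'.+1 then
    Tick (
      do! start then
      do! repeat tau single_flaw_step then
      let! b := proper_prog in
      if b then Ret tt else attempts start tau T')
  else start.

Definition sampler (R : realType) (start : prog unit) (delta : R) : prog unit :=
  let! delta1 := compute _ _ (delta / (k * #|G| + 1)%:R ^+ 2) in
  let! T := compute _ _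
    `|Num.ceil (ln (3 / delta) * (k * #|G| + 2)%:R ^+ 2)|%N in
  attempts start (mixing_time G k delta1) T.

End Algorithm.

Section Correctness.
Variables (R : realType) (G : sgraph) (k : nat).
Local Notation prog := (prog G k).
Local Notation coloring := (coloring G k).

(* From memory [s], [p] returns [a] and leaves memory [s'], whatever the
   random draws. *)
Definition yields A (p : prog A) (s : coloring) (a : A) (s' : coloring) :=
  forall (f : A -> prog unit) t,
    final_prob R (bind p f) s t = final_prob R (f a) s' t.

Lemma bindA A B C (p : prog A) (f : A -> prog B) (g : B -> prog C) :
  bind (bind p f) g = bind p (fun a => bind (f a) g).
Proof.
elim: p => //= [q ->|q IH|q IH|q IH|u v q IH|v q IH|v c q ->] //;
  by congr (_ _); apply: funext.
Qed.

Lemma bind_ret (p : prog unit) : bind p Ret = p.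
Proof.
elim: p => //= [q ->|q IH|q IH|q IH|u v q IH|v q IH|v c q ->] //;
  by congr (_ _); apply: funext.
Qed.

Lemma yields_ret A (a : A) s : yields (Ret a) s a s.
Proof. by []. Qed.

Lemma yields_bind A B (p : prog A) (f : A -> prog B) s a s' b s'' :
  yields p s a s' -> yields (f a) s' b s'' -> yields (bind p f) s b s''.
Proof. by move=> pa fb g t; rewrite bindA pa fb. Qed.

Lemma yields_all_in A (test : A -> prog bool) (P : pred A) s r :
  (forall x, yields (test x) s (P x) s) ->
  yields (all_in test r) s (all P r) s.
Proof.
move=> testP; elim: r => [|x r IH] //= f t.
rewrite /= (yields_bind (testP x) (b := P x && all P r) (s'' := s)) //.
by case: (P x).
Qed.

Lemma yields_first_in A (test : A -> prog bool) (P : pred A) s r :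
  (forall x, yields (test x) s (P x) s) ->
  yields (first_in test r) s (ohead [seq y <- r | P y]) s.
Proof.
move=> testP; elim: r => [|x r IH] //= f t.
rewrite /= (yields_bind (testP x) (b := ohead [seq y <- x :: r | P y]) (s'' := s)) //.
by rewrite /=; case: (P x).
Qed.

Lemma yields_proper s : yields (proper_prog G k) s (proper_coloring s) s.
Proof.
have -> : proper_coloring s =
    all (fun u => all (fun v => ~~ monochromatic s u v) (enum G)) (enum G).
  apply/forallP/allP => [sP u _|sP u].
    by apply/allP => v _; move/forallP: (sP u); apply.
  by apply/forallP => v; move/allP: (sP u (mem_enum G u)); apply; rewrite mem_enum.
by apply: yields_all_in => u; apply: yields_all_in.
Qed.

Lemma yields_in_Omega s :
  yields (in_Omega_prog G k) s (proper_coloring s || singly_flawed s) s.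
Proof.
apply: yields_bind; first exact: yields_proper.
have [//|sNP] := boolP (proper_coloring s).
have flawed : [exists u, exists v, monochromatic s u v].
  move: sNP; rewrite negb_forall => /existsP[u]; rewrite negb_forall.
  by move=> /existsP[v]; rewrite negbK => m; apply/existsP; exists u;
     apply/existsP; exists v.
rewrite /singly_flawed flawed /=.
pose P x := all (fun u => all (fun v =>
  monochromatic s u v ==> (x == u) || (x == v)) (enum G)) (enum G).
have PE x : P x = [forall u, forall v,
    monochromatic s u v ==> (x == u) || (x == v)].
  apply/allP/forallP => [sP u|sP u _].
    by apply/forallP => v; move/allP: (sP u (mem_enum G u)); apply;
       rewrite mem_enum.
  by apply/allP => v _; move/forallP: (sP u); apply.
have -> : [exists x, forall u, forall v,
    monochromatic s u v ==> (x == u) || (x == v)]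
    = isSome (ohead [seq y <- enum G | P y]).
  transitivity (has P (enum G)); last by rewrite has_filter; case: [seq _ <- _ | _].
  apply/existsP/hasP => [[x xP]|[x _ xP]]; exists x; rewrite ?mem_enum ?PE //.
  by rewrite -PE.
apply: yields_bind; last by [].
by apply: yields_first_in => x; apply: yields_all_in => u; apply: yields_all_in.
Qed.

Lemma recolor_undo (s : coloring) v c : recolor (recolor s v c) v (s v) = s.
Proof. by apply/ffunP => w; rewrite !ffunE; case: eqP => [->|]. Qed.

Lemma single_flaw_step_bind (s : Omega G k) (f : unit -> prog unit) t :
  final_prob R (bind (single_flaw_step G k) f) (val s) t =
  2^-1 * final_prob R (f tt) (val s) t +
  2^-1 * (\sum_(v : G) \sum_(c < k)
    (#|G| * k)%:R^-1 * final_prob R (f tt) (val (next_state s v c)) t).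
Proof.
rewrite /= big_bool /=; congr (_ + _); congr (_ * _).
apply: eq_bigr => v _; rewrite big_distrr; apply: eq_bigr => c _ /=.
rewrite mulrA natrM invfM; congr (_ * _).
rewrite bindA yields_in_Omega /next_state /insubd.
case: insubP => [s' -> <- //|/negbTE-> /=].
by rewrite recolor_undo.
Qed.

Lemma single_flaw_stepE (s s' : Omega G k) :
  final_prob R (single_flaw_step G k) (val s) (val s')
    = transition_prob R s s'.
Proof. by rewrite -[single_flaw_step _ _]bind_ret single_flaw_step_bind. Qed.

Lemma greedy_from_proper (todo colored : seq G) (s : coloring) :
  (max_degree G < k)%N -> uniq (colored ++ todo) ->
  {in colored &, forall u v, ~~ monochromatic s u v} ->
  exists2 s', yields (greedy_from k colored todo) s tt s' &
    {in colored ++ todo &, forall u v, ~~ monochromatic s' u v}.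
Proof.
move=> degk; elim: todo colored s => [|v todo IH] colored s.
  by rewrite cats0 => _ sP; exists s.
move=> uq sP.
pose P c := all (fun u => ~~ (edge u v && (s u == c))) colored.
have vN : v \notin colored.
  by move: uq; rewrite cat_uniq /= negb_or => /and3P[_ /andP[]].
have hasP : has P (enum 'I_k).
  apply: contraTT degk; rewrite -all_predC -leqNgt => /allP noc.
  apply: leq_trans (leq_bigmax v).
  rewrite -[leqLHS]card_ord -cardsT.
  apply: leq_trans (leq_imset_card s _); apply: subset_leq_card.
  apply/fintype.subsetP => c _; have /= := noc c (mem_enum _ c).
  case/allPn => u uc; rewrite negbK => /andP[uv /eqP <-].
  by apply: imset_f; rewrite inE edge_sym.
case E: [seq c <- enum 'I_k | P c] => [|c cs]; first by rewrite has_filter E in hasP.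
have Pc : P c.
  have : c \in [seq c <- enum 'I_k | P c] by rewrite E mem_head.
  by rewrite mem_filter => /andP[].
have [|x y|s' s'y s'P] := IH (v :: colored) (recolor s v c).
- by move: uq; rewrite -[v :: todo]cat1s uniq_catCA.
- rewrite /monochromatic !inE !ffunE.
  have [->|xv] := eqVneq x v; have [->|yv] := eqVneq y v => //=.
  + by rewrite edge_irrefl.
  + by move=> _ yc; have /allP/(_ _ yc) := Pc; rewrite edge_sym eq_sym.
  + by move=> xc _; have /allP/(_ _ xc) := Pc.
  + by move=> xc yc; apply: sP.
exists s'.
  move=> f t /=; rewrite bindA.
  rewrite (yields_first_in (P := P) (s := s)) ?E /=; last first.
    by move=> x; apply: yields_all_in.
  exact: s'y.
have sub z : z \in colored ++ v :: todo -> z \in (v :: colored) ++ todo.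
  by rewrite !(mem_cat, inE) orbCA orbA.
by move=> x y /sub xi /sub yi; apply: s'P.
Qed.

Lemma greedy_finds_proper :
  (max_degree G < k)%N -> finds_proper R (greedy G k).
Proof.
move=> degk s s'.
have [|//|s1 s1y s1P] :=
  greedy_from_proper (todo := enum G) (colored := [::]) (s := s) degk.
  exact: enum_uniq.
rewrite -[greedy _ _]bind_ret /greedy s1y /=.
case: (s1 =P s') => [<- _|_]; last by move=> /eqP[].
by apply/forallP => u; apply/forallP => v; apply: s1P; rewrite mem_enum.
Qed.

End Correctness.

(* Main.v *)
Require Import Defs.
From mathcomp Require Import all_boot all_order all_algebra.
From mathcomp Require Import all_classical all_reals all_analysis.
From mathcomp Require Import ring lra zify.

Import Order.TTheory GRing.Theory Num.Theory.
Local Open Scope ring_scope.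

Set Implicit Arguments.
Unset Strict Implicit.
Unset Printing Implicit Defensive.

(* The dynamics mixes because any proper coloring [sigma] can be turned into any
   other one [tau] through proper colorings only, by random trajectories that
   spread their load evenly.  Order the vertices by the last bag containing them
   and give them their color in [tau] one after the other; just before [v] gets
   its color, move its later neighbors out of the way, each to a uniformly random
   free color other than [tau v].  At any moment the current coloring [x] equals
   [tau] on the vertices already treated and [sigma] away from the set [B] of
   displaced vertices, and [B] lies in one bag.  Encoding [(sigma, tau)] by the
   opposite hybrid ([sigma] on the treated vertices, [tau] elsewhere), which is
   proper off [B], shows that at most
     N (k / (k - Delta))^|B| k^|B|
   of the [N ^ 2] pairs are compatible with [x], while a trajectory has
   probability at most [(k - Delta - 1)^-|B|] of displaying the colors of [x] on
   [B].  For [k = (1 + eps) Delta] the congestion is thus exponential in the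
   pathwidth only, hence polynomial in [n] when the pathwidth is [O(log n)].
   Repairing the flaw vertex extends the resulting Poincare inequality to all of
   [Omega], at the price of fibres of size at most [n k]; the same map shows that
   proper colorings have stationary mass at least [1 / (k n + 1)], so that the
   attempts of the sampler all fail with small probability only. *)

(** * Free colors, and the cost of dropping the constraints at a set of vertices *)

Section Colorings.
Variables (G : sgraph) (k : nat).
Local Notation coloring := (coloring G k).
Implicit Types (s x y : coloring) (u v w : G) (S B : {set G}) (c : 'I_k).

Definition proper_on S s : bool :=
  [forall u in S, forall v in S, ~~ monochromatic s u v].

Definition free_colors s u : {set 'I_k} :=
  [set c | [forall w, edge u w ==> (s w != c)]].

Lemma recolorE s u c w : recolor s u c w = if w == u then c else s w.
Proof. by rewrite ffunE. Qed.

Lemma proper_onP S s :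
  reflect {in S &, forall u v, edge u v -> s u != s v} (proper_on S s).
Proof.
apply: (iffP forall_inP) => [sP u v uS vS uv|sP u uS].
  by have /forall_inP/(_ v vS) := sP u uS; rewrite /monochromatic uv.
by apply/forall_inP => v vS; apply/negP => /andP[uv]; apply/negP/sP.
Qed.

Lemma proper_coloringP s :
  reflect (forall u v, edge u v -> s u != s v) (proper_coloring s).
Proof.
apply: (iffP forallP) => [sP u v uv|sP u].
  by have /forallP/(_ v) := sP u; rewrite /monochromatic uv.
by apply/forallP => v; apply/negP => /andP[uv]; apply/negP/sP.
Qed.

Lemma proper_onT s : proper_on [set: G] s = proper_coloring s.
Proof.
by apply/proper_onP/proper_coloringP => sP u v *; apply: sP => //; rewrite inE.
Qed.

Lemma card_free_colors s u : (k - max_degree G <= #|free_colors s u|)%N.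
Proof.
rewrite leq_subLR -[leqLHS]card_ord -(cardsC (free_colors s u)) addnC leq_add2r.
apply: leq_trans (leq_bigmax u).
apply: leq_trans (leq_imset_card s _); apply: subset_leq_card.
apply/fintype.subsetP => c; rewrite !inE negb_forall => /existsP[w].
by rewrite negb_imply negbK => /andP[uw /eqP <-]; apply: imset_f; rewrite inE.
Qed.

Lemma recolor_free_proper_on S s u c :
  proper_on S s -> c \in free_colors s u -> proper_on (u |: S) (recolor s u c).
Proof.
move=> /proper_onP sP; rewrite inE => /forallP cfree.
apply/proper_onP => v w; rewrite !inE !recolorE.
have [->|vu] := eqVneq v u; have [->|wu] := eqVneq w u => //=.
- by rewrite edge_irrefl.
- by move=> _ _ uw; rewrite eq_sym; move: (cfree w); rewrite uw.
- by move=> _ _ vu'; move: (cfree v); rewrite edge_sym vu'.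
- exact: sP.
Qed.

Lemma recolor_free_proper s u c :
  proper_coloring s -> c \in free_colors s u -> proper_coloring (recolor s u c).
Proof.
rewrite -!proper_onT => sP cP.
by rewrite -(finset.setUT [set u]); apply: recolor_free_proper_on.
Qed.

Lemma recolor_id s u : recolor s u (s u) = s.
Proof. by apply/ffunP => w; rewrite recolorE; case: eqP => [->|]. Qed.

Lemma recolor_recolor s u c c' : recolor (recolor s u c) u c' = recolor s u c'.
Proof. by apply/ffunP => w; rewrite !recolorE; case: eqP. Qed.

(** Double counting of the pairs [(s, c)] with [s] proper on [S] and [recolor s u c] proper on
    [u |: S]. Free colors give at least [k - max_degree G] of them for each [s]; conversely the pair
    is determined by the recolored coloring and the old color of [u]. *)
Lemma card_proper_onU1 S u :
  ((k - max_degree G) * #|[set s | proper_on S s]|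
    <= k * #|[set s | proper_on (u |: S) s]|)%N.
Proof.
pose A := [set s | proper_on S s]; pose A' := [set s | proper_on (u |: S) s].
apply: (@leq_trans (\sum_(s in A) \sum_(c < k) (recolor s u c \in A'))%N).
  rewrite mulnC -sum_nat_const; apply: leq_sum => s; rewrite inE => sP.
  apply: leq_trans (card_free_colors s u) _.
  rewrite -sum1_card big_mkcond; apply: leq_sum => c _.
  by case: ifP => // cP; rewrite inE recolor_free_proper_on.
apply: (@leq_trans (\sum_(p : coloring * 'I_k | p.1 \in A') 1)%N); last first.
  rewrite sum1dep_card -[X in (_ <= X * _)%N]card_ord mulnC -cardsT -cardsX.
  apply: subset_leq_card; apply/fintype.subsetP => -[s c].
  by rewrite !inE andbT.
rewrite pair_big_dep /=.
rewrite (bigID (fun p : coloring * 'I_k => recolor p.1 u p.2 \in A')) /=.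
rewrite [X in (_ + X)%N]big1 ?addn0; last by move=> p /andP[_ /negbTE->].
(* Exchanging the color of [u] with the second component is an involution on pairs. *)
rewrite (reindex_onto (fun p : coloring * 'I_k => (recolor p.1 u p.2, p.1 u))
  (fun p => (recolor p.1 u p.2, p.1 u))) /=; last first.
  by move=> [s c] _ /=; rewrite recolor_recolor recolor_id recolorE eqxx.
rewrite [leqRHS](bigID (fun p : coloring * 'I_k => true)) /=.
rewrite big_mkcond [X in (_ <= X + _)%N]big_mkcond /=.
apply: leq_trans (leq_addr _ _); apply: leq_sum => -[s c] _ /=.
rewrite recolor_recolor recolor_id; case: ifP => //= /andP[/andP[_ sA] _].
by rewrite sA.
Qed.

(** The vertices of [B] are put back one at a time, each at the price of a factor
    [k / (k - max_degree G)]. *)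
Lemma card_proper_on_setC B :
  ((k - max_degree G) ^ #|B| * #|[set s | proper_on (~: B) s]|
    <= k ^ #|B| * #|[set s | @proper_coloring G k s]|)%N.
Proof.
move: {2}#|B| (erefl #|B|) => b; elim: b B => [|b IH] B.
  move=> /cards0_eq->; rewrite finset.setC0 cards0 !expn0 !mul1n.
  by apply/subset_leq_card/fintype.subsetP => s; rewrite !inE proper_onT.
move=> Bb; have /set0Pn[u uB] : B != finset.set0 by rewrite -cards_eq0 Bb.
have := IH (B :\ u); rewrite (cardsD1 u) uB add1n in Bb; move: Bb => [Bb] /(_ Bb).
rewrite (cardsD1 u B) uB !Bb add1n !expnS => IHb.
have := card_proper_onU1 (~: B) u.
have -> : u |: ~: B = ~: (B :\ u).
  by apply/finset.setP => w; rewrite !inE negb_and negbK.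
by move=> /(leq_mul (leqnn ((k - max_degree G) ^ b)));
   move: (leq_mul (leqnn k) IHb); nia.
Qed.

End Colorings.

(** * Counting the pairs of colorings compatible with an intermediate coloring *)

Section Hybrids.
Variables (G : sgraph) (k : nat).
Local Notation coloring := (coloring G k).
Implicit Types (s x y : coloring) (u v w : G) (S D B : {set G}).

Definition agree S x y : bool := [forall w in S, y w == x w].

Lemma agreeP S x y : reflect {in S, x =1 y} (agree S x y).
Proof.
by apply: (iffP forall_inP) => h w wS; apply/eqP; rewrite ?h // eq_sym h.
Qed.

Lemma card_agree_setC B x : #|[set y | agree (~: B) x y]| = (k ^ #|B|)%N.
Proof.
pose F w : pred 'I_k := if w \in B then predT else pred1 (x w).
transitivity #|family F|.
  apply: eq_card => y; rewrite inE; apply/forall_inP/familyP => h w.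
    by rewrite /F; case: ifPn => // wB; rewrite inE h ?inE.
  by rewrite inE => wB; have := h w; rewrite /F (negbTE wB).
rewrite card_family foldrE big_map big_enum /=.
rewrite -prod_nat_const [RHS]big_mkcond; apply: eq_bigr => w _.
by rewrite /F; case: ifP => _; rewrite ?card1 // card_ord.
Qed.

(* The pair is encoded by the hybrid that follows [p.1] on [D] and [p.2]
   elsewhere, together with the colors of [p.1] on [B]. *)
Lemma card_hybrid_pairs x D B :
  [disjoint D & B] -> (forall u v, u \in D -> edge u v -> v \in D :|: B) ->
  (#|[set p : coloring * coloring |
      [&& proper_coloring p.1, proper_coloring p.2,
          agree (~: (D :|: B)) x p.1 & agree D x p.2]]|
    <= #|[set s : coloring | proper_on (~: B) s]| * k ^ #|B|)%N.
Proof.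
move=> DB nbD; set A := (X in (#|pred_of_set X| <= _)%N).
pose f (p : coloring * coloring) : coloring * coloring :=
  ([ffun w => if w \in D then p.1 w else p.2 w],
   [ffun w => if w \in B then p.1 w else x w]).
have f_inj : {in A &, injective f}.
  move=> [s t] [s' t']; rewrite !inE /=.
  move=> /and4P[_ _ /agreeP sx /agreeP tx] /and4P[_ _ /agreeP s'x /agreeP t'x].
  (* Colors that the code does not record are read off [x]: those of [p.1] outside [D :|: B] and
     those of [p.2] on [D]. *)
  case=> /ffunP e1 /ffunP e2; congr pair; apply/ffunP => w.
    have := e1 w; have := e2 w; rewrite !ffunE.
    case: ifPn => [_ //|wB _]; case: ifPn => [_ //|wD _].
    by rewrite -sx -?s'x // !inE negb_or wD.
  have := e1 w; rewrite !ffunE; case: ifPn => [wD _|//].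
  by rewrite -tx -?t'x.
rewrite -(card_in_imset f_inj) -(card_agree_setC B x) -cardsX.
apply/subset_leq_card/fintype.subsetP => _ /imsetP[[s t] + ->].
rewrite !inE /= => /and4P[/proper_coloringP sP /proper_coloringP tP _ _]; apply/andP; split.
  apply/proper_onP => u v; rewrite !inE !ffunE => uB vB uv.
  (* Off [B] no edge leaves [D], so each edge sees only one of the two proper colorings. *)
  case: ifPn => uD; case: ifPn => vD; [exact: sP| | |exact: tP].
    by move: (nbD _ _ uD uv); rewrite inE (negbTE vD) (negbTE vB).
  rewrite edge_sym in uv.
  by move: (nbD _ _ vD uv); rewrite inE (negbTE uD) (negbTE uB).
by apply/agreeP => w; rewrite inE ffunE => /negbTE->.
Qed.

End Hybrids.

(** * Vertex orders obtained from path decompositions *)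

Section EliminationOrder.
Variable G : sgraph.
Implicit Types (bags : seq {set G}) (u v w : G).

Let last_bag bags v : nat :=
  \max_(i < size bags | v \in nth finset.set0 bags i) i.

Let last_bagP bags v : path_decomposition bags ->
  (last_bag bags v < size bags)%N /\
  v \in nth finset.set0 bags (last_bag bags v).
Proof.
case=> /(_ v)[X Xin vX] _ _; have iX : (index X bags < size bags)%N.
  by rewrite index_mem.
rewrite /last_bag (bigop.bigmax_eq_arg (Ordinal iX)) /=; last by rewrite nth_index.
by case: arg_maxnP => [|i vi _]; rewrite /= ?nth_index.
Qed.

Let leq_last_bag bags v i : (i < size bags)%N ->
  v \in nth finset.set0 bags i -> (i <= last_bag bags v)%N.
Proof.
by move=> ib vi; apply: (leq_bigmax_cond (Ordinal ib) (P := fun i : 'I_ _ => _)).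
Qed.

(* Listing the vertices by the last bag that contains them puts the outer
   boundary of every initial segment into a single bag. *)
Lemma path_decomposition_order bags : path_decomposition bags ->
  exists2 ord : seq G, perm_eq ord (enum G) &
    forall d v r, ord = d ++ v :: r -> exists2 X, X \in bags &
      forall u, u \notin d -> (u == v) || has (fun w => edge w u) (rcons d v) ->
        u \in X.
Proof.
move=> bagsP; pose leB := relpre (last_bag bags) leq.
have leBtr : ssrbool.transitive leB by move=> y x z; apply: leq_trans.
have leBtot : total leB by move=> x y; apply: leq_total.
exists (sort leB (enum G)); first by rewrite perm_sort.
move=> d v r ordE.
have := sort_sorted leBtot (enum G); rewrite ordE sorted_pairwise //.
rewrite pairwise_cat /= => /and4P[/allrelP dr _ vr _].
have [iv vi] := last_bagP v bagsP.
exists (nth finset.set0 bags (last_bag bags v)); first exact: mem_nth.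
move=> u ud; have [-> //|uv /= /hasP[w]] := eqVneq u v.
have ur : u \in r.
  have : u \in sort leB (enum G) by rewrite mem_sort mem_enum.
  by rewrite ordE mem_cat inE (negbTE ud) (negbTE uv).
rewrite mem_rcons inE => wd wu.
have wv : (last_bag bags w <= last_bag bags v)%N.
  by case/predU1P: wd => [-> //|wd]; apply: dr; rewrite // mem_head.
have vu : (last_bag bags v <= last_bag bags u)%N by have /allP/(_ _ ur) := vr.
(* A bag [X] holding [w] and [u] comes no later than the last bag of [w], hence no later than that
   of [v], which in turn is not after that of [u]. As [u] lies in both outer bags, it lies in the
   middle one. *)
have [_ /(_ _ _ wu)[X Xb /andP[wX uX]] conn] := bagsP.
have ltX : (index X bags < size bags)%N by rewrite index_mem.
have Xv : (index X bags <= last_bag bags v)%N.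
  by apply: leq_trans wv; apply: leq_last_bag; rewrite ?nth_index.
have [iu ui] := last_bagP u bagsP.
have /fintype.subsetP := conn _ _ _ Xv vu iu.
by apply; rewrite inE ui nth_index ?uX.
Qed.

End EliminationOrder.

(** * Random trajectories: expectations, energies, agreement probabilities *)

Section Schedules.
Variables (R : realType) (G : sgraph) (k : nat).
Local Notation coloring := (coloring G k).
Implicit Types (s x y tau : coloring) (u v w : G) (S D B : {set G}).
Implicit Types (st : G * G) (sched pre post : seq (G * G)).
Implicit Types (F : coloring -> R) (Q : coloring -> Prop).

(* The step [(v, v)] gives [v] its target color [tau v]; for [u <> v] the step
   [(u, v)] moves [u] out of the way, to a random free color other than
   [tau v]. *)
Definition palette tau st x : {set 'I_k} :=
  if st.1 == st.2 then [set tau st.1] else free_colors x st.1 :\ tau st.2.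

Definition step_avg tau st F x : R :=
  #|palette tau st x|%:R^-1 * \sum_(c in palette tau st x) F (recolor x st.1 c).

(** Expected value of [F] at the end of the random trajectory, as a composition of averaging
    operators; no space of paths is needed. *)
Definition run tau sched F : coloring -> R := foldr (step_avg tau) F sched.

(** The sure counterpart of [run]: [Q] holds at the end of every trajectory, whichever palette
    colors are drawn. *)
Fixpoint ensures tau sched Q x : Prop :=
  if sched is st :: sched' then
    forall c, c \in palette tau st x -> ensures tau sched' Q (recolor x st.1 c)
  else Q x.

Lemma ensures_cat tau pre post Q x :
  ensures tau (pre ++ post) Q x <-> ensures tau pre (ensures tau post Q) x.
Proof.
by elim: pre x => //= st pre IH x; split=> h c cP; apply/IH/h.
Qed.

Lemma ensures_mono tau sched Q Q' x :
  (forall y, Q y -> Q' y) -> ensures tau sched Q x -> ensures tau sched Q' x.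
Proof.
move=> QQ'; elim: sched x => [x|st sched IH x h] /=; first exact: QQ'.
by move=> c cP; apply/IH/h.
Qed.

Lemma step_avg_le tau st F F' x :
  (forall c, c \in palette tau st x ->
     F (recolor x st.1 c) <= F' (recolor x st.1 c)) ->
  step_avg tau st F x <= step_avg tau st F' x.
Proof. by move=> FF'; rewrite ler_wpM2l ?invr_ge0 // ler_sum. Qed.

Lemma step_avgD tau st F F' x :
  step_avg tau st (fun y => F y + F' y) x =
  step_avg tau st F x + step_avg tau st F' x.
Proof. by rewrite /step_avg big_split mulrDr. Qed.

Lemma step_avgZ tau st a F x :
  step_avg tau st (fun y => a * F y) x = a * step_avg tau st F x.
Proof. by rewrite /step_avg -big_distrr mulrCA. Qed.

Lemma step_avg_sum (I : finType) tau st (F : I -> coloring -> R) x :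
  step_avg tau st (fun y => \sum_i F i y) x = \sum_i step_avg tau st (F i) x.
Proof. by rewrite /step_avg exchange_big big_distrr. Qed.

(** Only an inequality, since the average over an empty palette is 0. *)
Lemma step_avg_cst_le tau st a x : 0 <= a -> step_avg tau st (fun=> a) x <= a.
Proof.
move=> a0; rewrite /step_avg sumr_const -(mulr_natl a).
have [->|n0] := eqVneq #|palette tau st x| 0%N; first by rewrite mul0r mulr0.
by rewrite mulKf // pnatr_eq0.
Qed.

Lemma run_cat tau pre post F : run tau (pre ++ post) F = run tau pre (run tau post F).
Proof. exact: foldr_cat. Qed.

Lemma eq_run tau sched F F' x : F =1 F' -> run tau sched F x = run tau sched F' x.
Proof. by move=> /funext->. Qed.

Lemma run_le tau sched F F' x :
  ensures tau sched (fun y => F y <= F' y) x ->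
  run tau sched F x <= run tau sched F' x.
Proof.
elim: sched x => //= st sched IH x h.
by apply: step_avg_le => c cP; apply/IH/h.
Qed.

Lemma ensuresT tau sched Q x : (forall y, Q y) -> ensures tau sched Q x.
Proof. by move=> h; elim: sched x => //= st sched IH x c _. Qed.

Lemma runD tau sched F F' x :
  run tau sched (fun y => F y + F' y) x = run tau sched F x + run tau sched F' x.
Proof.
elim: sched x => //= st sched IH x.
by rewrite -step_avgD; congr step_avg; apply: funext.
Qed.

Lemma runZ tau sched a F x :
  run tau sched (fun y => a * F y) x = a * run tau sched F x.
Proof.
elim: sched x => //= st sched IH x.
by rewrite -step_avgZ; congr step_avg; apply: funext.
Qed.

Lemma run_sum (I : finType) tau sched (F : I -> coloring -> R) x :
  run tau sched (fun y => \sum_i F i y) x = \sum_i run tau sched (F i) x.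
Proof.
elim: sched x => //= st sched IH x.
by rewrite -step_avg_sum; congr step_avg; apply: funext.
Qed.

Section Energy.
Variable f : coloring -> R.

Definition step_energy tau st x : R :=
  step_avg tau st (fun y => (f x - f y) ^+ 2) x.

(** Expected sum of the squared increments of [f] along the trajectory. *)
Fixpoint energy tau sched x : R :=
  if sched is st :: sched' then
    step_avg tau st (fun y => (f x - f y) ^+ 2 + energy tau sched' y) x
  else 0.

Lemma energy_ge0 tau sched x : 0 <= energy tau sched x.
Proof.
elim: sched x => //= st sched IH x; rewrite mulr_ge0 ?invr_ge0 //.
by apply: sumr_ge0 => c _; rewrite addr_ge0 ?sqr_ge0.
Qed.

(** By linearity the energy splits into one expected squared increment per position of the schedule,
    so a bound that is uniform in the position is multiplied by the length. In the induction [pre]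
    collects the steps already made. *)
Lemma sum_energy_le (A : pred (coloring * coloring)) M sched pre :
  (forall pre' st post, sched = pre' ++ st :: post ->
     \sum_(p | A p) run p.2 (pre ++ pre') (step_energy p.2 st) p.1 <= M) ->
  \sum_(p | A p) run p.2 pre (energy p.2 sched) p.1 <= (size sched)%:R * M.
Proof.
elim: sched pre => [|st sched IH] pre h.
  rewrite mul0r big1 // => p _; rewrite -[RHS](mul0r (run p.2 pre (fun=> 0) p.1)).
  by rewrite -runZ; apply: eq_run => y /=; rewrite mulr0.
have eqE p : run p.2 pre (energy p.2 (st :: sched)) p.1 =
    run p.2 pre (step_energy p.2 st) p.1 +
    run p.2 (rcons pre st) (energy p.2 sched) p.1.
  rewrite -cats1 run_cat -runD; apply: eq_run => y /=.
  by rewrite /step_energy -step_avgD.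
rewrite (eq_bigr _ (fun p _ => eqE p)) big_split /= mulrSr mulrDl mul1r addrC.
apply: lerD.
  apply: IH => pre' st' post E; rewrite cat_rcons.
  by apply: (h (st :: pre') st' post); rewrite E.
by have := h [::] st sched erefl; rewrite cats0.
Qed.

End Energy.

Section EnoughColors.
Hypothesis degk : (max_degree G + 2 <= k)%N.
Local Notation m := (k - max_degree G).-1.

Lemma card_palette tau st x : st.1 != st.2 -> (m <= #|palette tau st x|)%N.
Proof.
move=> /negbTE ne; rewrite /palette ne.
have := card_free_colors x st.1; rewrite (cardsD1 (tau st.2)) => h.
rewrite -subn1 leq_subLR; apply: leq_trans h _.
by rewrite leq_add2r; case: (_ \in _).
Qed.

Lemma card_palette_gt0 tau st x : (0 < #|palette tau st x|)%N.
Proof.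
have [e|ne] := eqVneq st.1 st.2; first by rewrite /palette e eqxx cards1.
by apply: leq_trans (card_palette _ _ ne); lia.
Qed.

Lemma le_step_avg tau st a F x :
  (forall c, c \in palette tau st x -> a <= F (recolor x st.1 c)) ->
  a <= step_avg tau st F x.
Proof.
move=> aF; rewrite /step_avg ler_pdivlMl ?ltr0n ?card_palette_gt0 //.
by rewrite mulr_natl -sumr_const ler_sum.
Qed.

(* Cauchy-Schwarz along the trajectory. *)
Lemma sqr_diff_le_energy (f : coloring -> R) tau sched a x :
  ensures tau sched (fun y => f y = a) x ->
  (f x - a) ^+ 2 <= (size sched)%:R * energy f tau sched x.
Proof.
elim: sched x => [x /= ->|st sched IH x /= h]; first by rewrite subrr expr0n mul0r.
rewrite -step_avgZ; apply: le_step_avg => c cP.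
have := IH _ (h c cP); have := energy_ge0 f tau sched (recolor x st.1 c).
move: (energy _ _ _ _) => e; set y := recolor _ _ _.
have -> : f x - a = (f x - f y) + (f y - a) by ring.
move: (f x - f y) (f y - a) => p q e0; rewrite -natr1.
have : 0 <= (size sched)%:R :> R by [].
move: (size sched)%:R => L L0 qe.
have [L0'|Lne] := eqVneq L 0.
  have -> : q = 0 by apply/eqP; rewrite -sqrf_eq0 eq_le sqr_ge0 andbT; rewrite L0' mul0r in qe.
  by rewrite L0' addr0 add0r mul1r lerDl.
have Lgt : 0 < L by rewrite lt0r Lne.
rewrite -(ler_pM2l Lgt).
(* This square is the gap in [L * (p + q) ^+ 2 <= (L + 1) * (L * p ^+ 2 + q ^+ 2)], where [q ^+ 2]
   is then bounded by [L * e]. *)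
have : 0 <= (L * p - q) ^+ 2 by exact: sqr_ge0.
have : 0 <= L * (L * e - q ^+ 2) by rewrite mulr_ge0 ?subr_ge0.
by move=> h1 h2; nra.
Qed.

(** The displaced vertices: those moved out of the way and not yet given their target color. *)
Definition randomized pre : {set G} :=
  foldl (fun B st => if st.1 == st.2 then B :\ st.1 else st.1 |: B)
    finset.set0 pre.

Definition touched pre : {set G} := [set st.1 | st in pre].

Lemma randomized_rcons pre st : randomized (rcons pre st) =
  if st.1 == st.2 then randomized pre :\ st.1 else st.1 |: randomized pre.
Proof. by rewrite /randomized foldl_rcons. Qed.

(** Only [st.1] changes, so agreement elsewhere must hold beforehand. A displacement hits the
    prescribed color with probability at most [m%:R^-1]; for a setting step the trivial bound 1 is
    kept. *)
Lemma step_avg_agree_le tau st S x y :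
  step_avg tau st (fun z => (agree S x z)%:R) y <=
  (if (st.1 \in S) && (st.1 != st.2) then m%:R^-1 else 1) *
  (agree (S :\ st.1) x y)%:R.
Proof.
have agr c : agree S x (recolor y st.1 c) =
    ((st.1 \in S) ==> (c == x st.1)) && agree (S :\ st.1) x y.
  apply/agreeP/andP => [h|[h1 /agreeP h2] w wS].
    split; first by apply/implyP => uS; rewrite h // recolorE eqxx.
    by apply/agreeP => w; rewrite !inE => /andP[/negbTE wu wS]; rewrite h // recolorE wu.
  rewrite recolorE; case: eqVneq wS => [-> uS|wu wS].
    by move: h1; rewrite uS => /eqP.
  by rewrite h2 // !inE wu.
have [uS|uS] := boolP (st.1 \in S) => /=; last first.
  rewrite mul1r;
  apply: le_trans (step_avg_cst_le tau st y (ler0n _ _)).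
  by apply: step_avg_le => c _; rewrite agr (negbTE uS).
have [e|ne] := eqVneq st.1 st.2 => /=.
  rewrite mul1r; apply: le_trans (step_avg_cst_le tau st y (ler0n _ _)).
  by apply: step_avg_le => c _; rewrite agr ler_nat; case: (_ ==> _).
apply: ler_pM.
- by rewrite invr_ge0.
- by apply: sumr_ge0.
- rewrite lef_pV2 ?posrE ?ltr0n ?card_palette_gt0 ?ler_nat ?card_palette //; lia.
under eq_bigr do rewrite agr uS /=.
rewrite (le_trans (y := \sum_(c < k) ((c == x st.1) && agree (S :\ st.1) x y)%:R)) //.
  by rewrite [leLHS]big_mkcond ler_sum // => c _; case: ifP.
rewrite (bigD1 (x st.1)) //= eqxx big1 ?addr0 // => c /negbTE->; by [].
Qed.

(** Peeling off the steps from the last one, each vertex still displaced contributes one factor,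
    that of its latest move; once that vertex has been removed from [S], its earlier moves cost
    nothing. Vertices never touched still carry their color in [y]. *)
Lemma run_agree_le tau pre S x y :
  run tau pre (fun z => (agree S x z)%:R) y <=
  m%:R^-1 ^+ #|S :&: randomized pre| * (agree (S :\: touched pre) x y)%:R.
Proof.
elim/last_ind: pre S => [|pre st IH] S.
  rewrite /= finset.setI0 cards0 mul1r.
  suff -> : S :\: touched [::] = S by [].
  apply/finset.setP => w; rewrite !inE andbC; case: (w \in S) => //=.
  by apply/imsetP => -[].
rewrite -cats1 run_cat cats1 /=.
apply: le_trans.
  apply: (run_le (F' := fun z => _ * (agree (S :\ st.1) x z)%:R)).
  by apply: ensuresT => z; apply: step_avg_agree_le.
rewrite runZ; apply: le_trans.
  by apply: ler_wpM2l (IH _); case: ifP; rewrite ?invr_ge0.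
rewrite mulrA; apply: ler_pM.
- by rewrite mulr_ge0 ?exprn_ge0 ?invr_ge0 //; case: ifP; rewrite ?invr_ge0.
- by [].
- rewrite randomized_rcons.
  have [e|ne] /= := eqVneq st.1 st.2; rewrite ?andbF ?andbT ?mul1r.
    suff -> : (S :\ st.1) :&: randomized pre = S :&: (randomized pre :\ st.1) by [].
    by apply/finset.setP => w; rewrite !inE; case: eqP; rewrite ?andbF.
  have [uS|uS] := boolP (st.1 \in S).
    rewrite -exprS (cardsD1 st.1 (S :&: _)) !inE uS eqxx /= add1n.
    suff -> : (S :\ st.1) :&: randomized pre = (S :&: (st.1 |: randomized pre)) :\ st.1 by [].
    by apply/finset.setP => w; rewrite !inE; case: eqP.
  rewrite mul1r.
  suff -> : (S :\ st.1) :&: randomized pre = S :&: (st.1 |: randomized pre) by [].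
  apply/finset.setP => w; rewrite !inE; case: eqVneq => // ->.
  by rewrite (negbTE uS).
rewrite ler_nat.
suff -> : (S :\ st.1) :\: touched pre = S :\: touched (rcons pre st) by [].
apply/finset.setP => w; rewrite !inE andbA; congr (_ && _).
apply/idP/idP => [/andP[w1 w2]|w1].
  apply/imsetP => -[st']; rewrite mem_rcons inE => /predU1P[->|st'p] we.
    by rewrite we eqxx in w2.
  by case/imsetP: w1; exists st'.
rewrite andbC; apply/andP; split.
  by apply: contra w1 => /eqP->; apply: imset_f; rewrite mem_rcons mem_head.
apply: contra w1 => /imsetP[st' st'p ->]; apply: imset_f.
by rewrite mem_rcons inE st'p orbT.
Qed.

End EnoughColors.
End Schedules.

Lemma cat_eq_cons_split (T : Type) (a c pre post : seq T) x :
  a ++ c = pre ++ x :: post ->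
  (exists a', a = pre ++ x :: a') \/ (exists2 p, pre = a ++ p & c = p ++ x :: post).
Proof.
elim: a pre => [|y a IH] [|z pre] /=; first by right; exists [::].
- by right; exists (z :: pre).
- by case=> -> _; left; exists a.
by case=> -> /IH[[a' ->]|[p -> ->]]; [left; exists a'|right; exists p].
Qed.

(** * The schedule attached to a vertex order, and its invariants *)

Section EliminationFlow.
Variables (G : sgraph) (k : nat) (ord : seq G).
Hypothesis ord_perm : perm_eq ord (enum G).
Local Notation coloring := (coloring G k).
Implicit Types (u v w : G) (d r us : seq G) (st : G * G) (pre post : seq (G * G)).

Let mem_ord u : u \in ord.
Proof. by rewrite (perm_mem ord_perm) mem_enum. Qed.

Let uniq_ord : uniq ord.
Proof. by rewrite (perm_uniq ord_perm) enum_uniq. Qed.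

Definition later_neighbors v : seq G :=
  [seq u <- enum G | edge v u && (index v ord < index u ord)%N].

Definition block v : seq (G * G) :=
  rcons [seq (u, v) | u <- later_neighbors v] (v, v).

Definition schedule d : seq (G * G) := flatten [seq block v | v <- d].

Lemma schedule_rcons d v : schedule (rcons d v) = schedule d ++ block v.
Proof. by rewrite /schedule -cats1 map_cat flatten_cat /= cats0. Qed.

Lemma index_order_lt d v r u : ord = d ++ v :: r ->
  (index v ord < index u ord)%N = (u \notin rcons d v).
Proof.
move=> E; have : v \notin d.
  by move: uniq_ord; rewrite E cat_uniq /= negb_or => /and3P[_ /andP[]].
rewrite E !index_cat mem_rcons inE /= eqxx addn0 => /negbTE->.
rewrite [v == u]eq_sym; case: (boolP (u \in d)) => [ud|_]; last first.
  by case: eqP => _ /=; lia.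
by rewrite orbT ltnNge ltnW // index_mem.
Qed.

Lemma mem_later_neighbors d v r u : ord = d ++ v :: r ->
  (u \in later_neighbors v) = edge v u && (u \notin rcons d v).
Proof.
by move=> E; rewrite mem_filter mem_enum andbT (index_order_lt _ E).
Qed.

Lemma mem_schedule d u w : ((u, w) \in schedule d) =
  (w \in d) && ((u == w) || (u \in later_neighbors w)).
Proof.
apply/flattenP/andP => [[_ /mapP[v vd ->]]|[wd uw]].
  rewrite mem_rcons inE => /predU1P[[-> ->]|]; first by rewrite eqxx.
  by move=> /mapP[u' u'v [-> ->]]; rewrite vd u'v orbT.
exists (block w); first exact: map_f.
rewrite mem_rcons inE xpair_eqE eqxx andbT.
by case/orP: uw => [->//|uw]; rewrite orbC map_f.
Qed.

Lemma randomized_cat_map pre us v : v \notin us ->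
  randomized (pre ++ [seq (u, v) | u <- us]) = [set u in us] :|: randomized pre.
Proof.
elim/last_ind: us => [|us u IH] vus.
  by rewrite cats0; apply/finset.setP => w; rewrite !inE.
move: vus; rewrite mem_rcons inE negb_or => /andP[vu vus].
rewrite map_rcons -rcons_cat randomized_rcons /= eq_sym (negbTE vu) IH //.
by apply/finset.setP => w; rewrite !inE mem_rcons inE orbA.
Qed.

Lemma later_neighbors_self v : v \notin later_neighbors v.
Proof. by rewrite mem_filter edge_irrefl. Qed.

(** The block of [v] adds the later neighbors of [v] and finally removes [v], so after complete
    blocks the displaced vertices form the outer boundary of [d]. *)
Lemma randomized_schedule d r : ord = d ++ r ->
  randomized (schedule d) = [set u | (u \notin d) && has (fun w => edge w u) d].
Proof.
elim/last_ind: d r => [|d v IH] r E; first by apply/finset.setP => w; rewrite !inE.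
rewrite cat_rcons in E; rewrite schedule_rcons /block -rcons_cat randomized_rcons /=.
rewrite eqxx (randomized_cat_map _ (later_neighbors_self v)) (IH _ E).
apply/finset.setP => u; rewrite !inE (mem_later_neighbors _ E) mem_rcons inE.
rewrite has_rcons negb_or; case: eqP => //= _.
by case: (u \in d) => //=; case: (edge v u).
Qed.

Lemma randomized_prefix d v r us : ord = d ++ v :: r ->
  {subset us <= later_neighbors v} ->
  randomized (schedule d ++ [seq (u, v) | u <- us]) =
  [set u | (u \notin d) && ((u \in us) || has (fun w => edge w u) d)].
Proof.
move=> E sub; rewrite randomized_cat_map; last first.
  by apply/negP => /sub; apply/negP/later_neighbors_self.
rewrite (randomized_schedule E); apply/finset.setP => u; rewrite !inE.
have [/sub|//] := boolP (u \in us).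
  by rewrite (mem_later_neighbors _ E) mem_rcons inE negb_or /= => /and3P[_ _ ->].
Qed.

(** Identifies the untouched vertices, where the starting coloring survives, with the complement of
    [D :|: B] in the hybrid count. *)
Lemma touched_prefix d v r us : ord = d ++ v :: r ->
  {subset us <= later_neighbors v} ->
  touched (schedule d ++ [seq (u, v) | u <- us]) =
  [set u in d] :|: randomized (schedule d ++ [seq (u, v) | u <- us]).
Proof.
move=> E sub; rewrite (randomized_prefix E sub); apply/finset.setP => u.
rewrite !inE; have [ud|ud] /= := boolP (u \in d).
  apply/imsetP; exists (u, u) => //.
  by rewrite mem_cat mem_schedule ud eqxx.
apply/imsetP/orP => [[[u' w]]|[uus|/hasP[w wd wu]]].
- rewrite mem_cat => + /= uE; rewrite {u}uE in ud *; rewrite mem_schedule.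
  case/orP => [/andP[wd]|/mapP[u2 h [-> _]]].
    case/predU1P => [uw|]; first by rewrite uw wd in ud.
    by rewrite mem_filter => /andP[/andP[wu _] _]; right; apply/hasP; exists w.
  by left.
- by exists (u, v) => //; rewrite mem_cat map_f ?orbT.
exists (u, w) => //; rewrite mem_cat mem_schedule wd.
case/splitPr: wd E ud => d1 d2; rewrite -catA cat_cons => E ud.
rewrite (mem_later_neighbors _ E) wu mem_rcons inE negb_or /=.
move: ud; rewrite mem_cat inE !negb_or => /and3P[-> -> _].
by rewrite orbT.
Qed.

(** Normal form of a moment of the trajectory: complete blocks, then some displacements made for one
    vertex [v]. When [v] itself is about to be set, all its displacements are done, which is what
    makes its target color free. *)
Lemma schedule_split pre st post : schedule ord = pre ++ st :: post ->
  exists d v r us, [/\ ord = d ++ v :: r,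
    pre = schedule d ++ [seq (u, v) | u <- us],
    {subset us <= later_neighbors v} &
    st = (v, v) /\ us = later_neighbors v \/
    exists2 u, u \in later_neighbors v & st = (u, v)].
Proof.
have gen l : schedule l = pre ++ st :: post -> exists d v r b b',
    [/\ l = d ++ v :: r, pre = schedule d ++ b & block v = b ++ st :: b'].
  elim: l pre => [|w l IH] [|x pre'] //=; rewrite /schedule /= -/(schedule l).
    move=> h; have [[a' Ew]|[p E _]] :=
      @cat_eq_cons_split _ (block w) (schedule l) [::] _ _ h.
      by exists [::], w, l, [::], a'.
    by move: E; rewrite /block; case: (later_neighbors w).
  move=> h; have [[a' Ew]|[p -> /IH[d [v [r [b [b' [-> -> Ev]]]]]]]] :=
      @cat_eq_cons_split _ (block w) (schedule l) (x :: pre') _ _ h.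
    by exists [::], w, l, (x :: pre'), a'.
  exists (w :: d), v, r, b, b'; split=> //.
  by rewrite /schedule /= catA.
move=> /gen[d [v [r [b [b' [E -> Ev]]]]]]; exists d, v, r.
rewrite /block -cats1 in Ev; have [[a' Ev']|[p -> Ep]] := cat_eq_cons_split Ev.
  exists (take (size b) (later_neighbors v)); split=> //; last first.
  - right; have : st \in [seq (u, v) | u <- later_neighbors v].
      by rewrite Ev' mem_cat mem_head orbT.
    by case/mapP => u uv ->; exists u.
  - by move=> u /mem_take.
  - by rewrite map_take Ev' take_size_cat.
exists (later_neighbors v); case: p Ep => [[<-] _|x [|//] //].
by rewrite cats0; split=> //; left.
Qed.

Lemma size_schedule : (size (schedule ord) <= #|G| * #|G|.+1)%N.
Proof.
rewrite size_flatten /shape -map_comp sumnE big_map (perm_big _ ord_perm) /=.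
rewrite big_enum /= -[X in (_ <= X * _)%N]sum1_card big_distrl /=.
apply: leq_sum => v _; rewrite mul1n size_rcons size_map ltnS.
by rewrite cardE size_filter count_size.
Qed.

Section Trajectories.
Variable tau : coloring.
Hypothesis tauP : proper_coloring tau.
Implicit Types x y sigma : coloring.

Let avoids us v y := {in us, forall u, y u != tau v}.

Lemma ensures_randomize d v r us x : ord = d ++ v :: r ->
  {subset us <= later_neighbors v} -> proper_coloring x -> {in d, x =1 tau} ->
  ensures tau [seq (u, v) | u <- us]
    (fun y => [/\ proper_coloring y, {in d, y =1 tau} & avoids us v y]) x.
Proof.
move=> E sub xP xd.
(* The induction has to remember the neighbors [us'] moved so far: later displacements also avoid
   [tau v], so they do not spoil what was gained. *)
suff gen us' : avoids us' v x ->
    ensures tau [seq (u, v) | u <- us] (fun y =>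
      [/\ proper_coloring y, {in d, y =1 tau} & avoids (us' ++ us) v y]) x.
  by apply: (gen [::]).
elim: us us' x sub xP xd => [|u us IH] us' x sub xP xd xus' /=.
  by rewrite cats0.
have uv : u != v.
  by apply/eqP => uv; have := sub u (mem_head _ _); rewrite uv; apply/negP/later_neighbors_self.
have ud : u \notin d.
  have := sub u (mem_head _ _).
  by rewrite (mem_later_neighbors _ E) mem_rcons inE negb_or => /and3P[].
rewrite {1}/palette /= (negbTE uv) => c; rewrite !inE => /andP[ctau cfree].
rewrite -cat_rcons; apply: IH.
- by move=> w wus; apply: sub; rewrite inE wus orbT.
- by apply: recolor_free_proper => //; rewrite inE.
- by move=> w wd; rewrite recolorE; case: eqP ud => [<-|_ _]; rewrite ?wd // xd.
move=> w; rewrite mem_rcons inE recolorE; case: eqP => [_ _|_ /=]; first by [].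
exact: xus'.
Qed.

(** Treated neighbors of [v] wear their target colors, which differ from [tau v] because [tau] is
    proper; the later ones have been moved off [tau v]. *)
Lemma set_step_free d v r y : ord = d ++ v :: r -> {in d, y =1 tau} ->
  avoids (later_neighbors v) v y -> tau v \in free_colors y v.
Proof.
move=> E yd yav; rewrite inE; apply/forallP => w; apply/implyP => vw.
have [wd|wd] := boolP (w \in d).
  by rewrite yd // eq_sym; have /proper_coloringP := tauP; apply.
apply: yav; rewrite (mem_later_neighbors _ E) vw mem_rcons inE negb_or wd andbT.
by apply/eqP => wv; rewrite wv edge_irrefl in vw.
Qed.

Lemma ensures_schedule d r sigma : ord = d ++ r -> proper_coloring sigma ->
  ensures tau (schedule d)
    (fun y => proper_coloring y /\ {in d, y =1 tau}) sigma.
Proof.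
elim/last_ind: d r => [|d v IH] r //; rewrite cat_rcons => E sP.
rewrite schedule_rcons; apply/ensures_cat.
apply: ensures_mono (IH _ E sP) => y [yP yd].
rewrite /block -cats1; apply/ensures_cat.
apply: ensures_mono (ensures_randomize E _ yP yd) => // z [zP zd zav].
rewrite /= /palette eqxx => c /set1P->; split.
  exact: recolor_free_proper (set_step_free E zd zav).
move=> w; rewrite mem_rcons inE recolorE; case: eqP => [-> //|_ /=]; exact: zd.
Qed.

Lemma ensures_schedule_end sigma : proper_coloring sigma ->
  ensures tau (schedule ord) (fun y => y = tau) sigma.
Proof.
move=> sP; apply: ensures_mono (ensures_schedule (esym (cats0 _)) sP) => y [_ h].
by apply/ffunP => w; apply/h/mem_ord.
Qed.

(** What the energy estimate needs at each moment: the next move joins two proper colorings, hence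
    is counted in [recolor_energy], and the current coloring already follows [tau] on [d]. *)
Lemma ensures_prefix d v r us st sigma : ord = d ++ v :: r ->
  {subset us <= later_neighbors v} ->
  st = (v, v) /\ us = later_neighbors v \/
    (exists2 u, u \in later_neighbors v & st = (u, v)) ->
  proper_coloring sigma ->
  ensures tau (schedule d ++ [seq (u, v) | u <- us])
    (fun y => [/\ proper_coloring y, {in d, y =1 tau} &
       forall c, c \in palette tau st y -> proper_coloring (recolor y st.1 c)])
    sigma.
Proof.
move=> E sub stE sP; apply/ensures_cat.
apply: ensures_mono (ensures_schedule E sP) => y [yP yd].
apply: ensures_mono (ensures_randomize E sub yP yd) => z [zP zd zav].
split=> // c; rewrite /palette; case: stE => [[-> usE]|[u uv ->]] /=.
  rewrite usE in zav; rewrite eqxx => /set1P->.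
  exact: recolor_free_proper (set_step_free E zd zav).
have [uv'|_ /finset.setD1P[_ cfree]] := eqVneq u v.
  by move: uv; rewrite uv' (negbTE (later_neighbors_self v)).
exact: recolor_free_proper.
Qed.

End Trajectories.
End EliminationFlow.

(** * Poincare inequality on the proper colorings *)

Section ProperPoincare.
Variables (R : realType) (G : sgraph) (k : nat).
Hypothesis degk : (max_degree G + 2 <= k)%N.
Local Notation coloring := (coloring G k).
Local Notation m := (k - max_degree G).-1.
Variable f : coloring -> R.

(** Unnormalized Dirichlet form of the single-vertex recolorings between proper colorings. *)
Definition recolor_energy : R :=
  \sum_(u : G) \sum_(x : coloring | proper_coloring x)
    \sum_(c < k | proper_coloring (recolor x u c)) (f x - f (recolor x u c)) ^+ 2.

(** Congestion per displaced vertex: [k / (k - max_degree G)] for the lost constraints and [k] for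
    the recorded color, against the probability [m%:R^-1] of a prescribed color. *)
Definition spread : R := k%:R ^+ 2 / ((k - max_degree G)%:R * m%:R).

Lemma spread_ge1 : 1 <= spread.
Proof.
rewrite /spread ler_pdivlMr ?mulr_gt0 ?ltr0n //; [|lia|lia].
by rewrite mul1r expr2 ler_pM // ler_nat; lia.
Qed.

Variables (bags : seq {set G}) (b : nat).
Hypothesis bagsP : path_decomposition bags.
Hypothesis bagsb : {in bags, forall X : {set G}, (#|X| <= b)%N}.

Let pairs (p : coloring * coloring) := proper_coloring p.1 && proper_coloring p.2.
Let N : R := #|[set s | @proper_coloring G k s]|%:R.

(** The congestion bound: [card_hybrid_pairs] and [card_proper_on_setC] bound the number of
    compatible pairs, and the weight [m%:R^-1 ^+ #|B|] turns this number into
    [N * spread ^+ #|B|]. *)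
Let hybrid_mass x (D B : {set G}) :
  [disjoint D & B] -> (forall u v, u \in D -> edge u v -> v \in D :|: B) ->
  (#|B| <= b)%N ->
  \sum_(p | pairs p) (agree D x p.2)%:R *
     (m%:R^-1 ^+ #|B| * (agree (~: (D :|: B)) x p.1)%:R) <= N * spread ^+ b.
Proof.
move=> DB nbD Bb; rewrite -(eq_bigr _ (fun p _ => mulrCA _ _ _)) -big_distrr /=.
have -> : \sum_(p | pairs p)
    (agree D x p.2)%:R * (agree (~: (D :|: B)) x p.1)%:R =
  #|[set p : coloring * coloring |
      [&& proper_coloring p.1, proper_coloring p.2,
          agree (~: (D :|: B)) x p.1 & agree D x p.2]]|%:R :> R.
  rewrite -sum1dep_card natr_sum big_mkcond [RHS]big_mkcond.
  apply: eq_bigr => -[s t] _; rewrite /pairs /= -natrM mulnb.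
  case: (proper_coloring s) => //=; case: (proper_coloring t) => //=.
  by rewrite andbC; case: (_ && _).
have mgt0 : 0 < m%:R :> R by rewrite ltr0n; lia.
have Dgt0 : 0 < (k - max_degree G)%:R :> R by rewrite ltr0n; lia.
apply: (@le_trans _ _ (N * spread ^+ #|B|)); last first.
  by rewrite ler_wpM2l ?ler0n // ler_weXn2l // spread_ge1.
have := card_hybrid_pairs x DB nbD; have := @card_proper_on_setC G k B.
rewrite -(ler_nat R) !natrM !natrX -/N => h1 h2.
rewrite exprVn ler_pdivrMl ?exprn_gt0 //.
rewrite -(ler_nat R) !natrM natrX in h2; apply: le_trans h2 _.
rewrite /spread expr_div_n [(_ * m%:R) ^+ _]exprMn exprAC.
move: (exprn_gt0 #|B| mgt0) (exprn_gt0 #|B| Dgt0) (exprn_ge0 #|B| (ler0n R k)) h1.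
move: (m%:R ^+ #|B|) ((k - _)%:R ^+ #|B|) (k%:R ^+ #|B|) => M D' K M0 D0 K0 h1.
have -> : M * (N * (K ^+ 2 / (D' * M))) = K * N * K / D'.
  by field; rewrite !gt_eqF.
rewrite ler_pdivlMr //; apply: le_trans (ler_wpM2r K0 h1).
by rewrite [leLHS]mulrC mulrA.
Qed.

(** The expectation is expanded over the coloring [x] at which the step is made. The probability of
    being at [x] is at most that given by [run_agree_le], and summing it over the pairs is
    [hybrid_mass]. The displaced set fits into one bag, whence the exponent [b]. *)
Lemma step_energy_sum_le ord pre st post :
  perm_eq ord (enum G) ->
  (forall d v r, ord = d ++ v :: r -> exists2 X, X \in bags &
     forall u, u \notin d -> (u == v) || has (fun w => edge w u) (rcons d v) ->
       u \in X) ->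
  schedule ord ord = pre ++ st :: post ->
  \sum_(p | pairs p) run p.2 pre (step_energy f p.2 st) p.1 <=
    N * spread ^+ b * recolor_energy.
Proof.
move=> ordP ordB /schedule_split[d [v [r [us [E preE sub stE]]]]].
pose D : {set G} := [set u in d]; pose B := randomized pre.
have BE : B = [set u | (u \notin d) && ((u \in us) || has (fun w => edge w u) d)].
  by rewrite /B preE (randomized_prefix ordP E sub).
have TE : ~: touched pre = ~: (D :|: B).
  by rewrite preE (touched_prefix ordP E sub) -preE.
have DB : [disjoint D & B].
  by rewrite -setI_eq0; apply/eqP/finset.setP => u; rewrite BE !inE; case: (_ \in d).
have nbD u w : u \in D -> edge u w -> w \in D :|: B.
  rewrite BE !inE => ud uw; case: (w \in d) => //=.
  by apply/orP; right; apply/hasP; exists u.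
have Bb : (#|B| <= b)%N.
  have [X Xb h] := ordB _ _ _ E; apply: leq_trans (bagsb Xb).
  apply/subset_leq_card/fintype.subsetP => u; rewrite BE inE => /andP[ud ub].
  apply: h => //; rewrite has_rcons orbA.
  case/orP: ub => [/sub|->]; last by rewrite orbT.
  by rewrite (mem_later_neighbors ordP _ E) => /andP[-> _]; rewrite orbT.
pose dl x : R := \sum_(c < k | proper_coloring (recolor x st.1 c))
  (f x - f (recolor x st.1 c)) ^+ 2.
have dl0 x : 0 <= dl x by apply: sumr_ge0 => c _; apply: sqr_ge0.
apply: (@le_trans _ _ (\sum_(p | pairs p) \sum_x (proper_coloring x)%:R * dl x *
   ((agree D x p.2)%:R *
     (m%:R^-1 ^+ #|B| * (agree (~: (D :|: B)) x p.1)%:R)))).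
  apply: ler_sum => -[s t] /andP[/= sP tP].
  (* Agreement on [[set: G]] singles out [x = y]. The factor [agree D x t] can be inserted because
     the trajectory equals [t] on [D]. *)
  apply: (@le_trans _ _ (run t pre (fun y => \sum_x
      ((proper_coloring x)%:R * dl x * (agree D x t)%:R) *
      (agree [set: G] x y)%:R) s)).
    apply: run_le; have := ensures_prefix ordP tP E sub stE sP; rewrite -preE.
    apply: ensures_mono => y [yP yd yst].
    rewrite (bigD1 y) //= yP mul1r.
    have -> : agree D y t by apply/agreeP => w; rewrite inE => wd; rewrite yd.
    have -> : agree [set: G] y y by apply/agreeP.
    rewrite !mulr1 -[leLHS]addr0 lerD //; last first.
      by apply: sumr_ge0 => x _; rewrite !mulr_ge0.
    rewrite /step_energy /step_avg /dl.
    rewrite ler_pdivrMl ?ltr0n ?card_palette_gt0 //.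
    (* Palette colors lead to proper colorings, and the palette being nonempty, an average over it
       is at most the full sum. *)
    apply: (@le_trans _ _ (\sum_(c < k | proper_coloring (recolor y st.1 c))
      (f y - f (recolor y st.1 c)) ^+ 2)).
      rewrite [leLHS]big_mkcond [leRHS]big_mkcond; apply: ler_sum => c _.
      by case: ifP => [/yst->//|_]; case: ifP => // _; apply: sqr_ge0.
    by rewrite ler_peMl ?ler1n ?card_palette_gt0 //; apply: dl0.
  rewrite run_sum; apply: ler_sum => x _; rewrite runZ -mulrA.
  apply: ler_wpM2l; first by rewrite mulr_ge0.
  apply: ler_wpM2l => //.
  have := run_agree_le R degk t pre [set: G] x s.
  by rewrite finset.setTI finset.setTD TE.
rewrite exchange_big /= mulrC /recolor_energy (bigD1 st.1) //= mulrDl.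
rewrite -[leLHS]addr0 lerD //; last first.
  rewrite mulr_ge0 ?mulr_ge0 ?exprn_ge0 // ?(le_trans ler01 spread_ge1) //.
  by apply: sumr_ge0 => u _; apply: sumr_ge0 => x _; apply: sumr_ge0 => c _; apply: sqr_ge0.
rewrite [X in _ <= X * _]big_mkcond mulr_suml; apply: ler_sum => x _.
rewrite -big_distrr /=; case: ifP => _; last by rewrite !mul0r.
by rewrite mul1r ler_wpM2l // hybrid_mass.
Qed.

(** The length of the schedule enters twice: once through Cauchy-Schwarz along the trajectory, once
    through the sum over the positions. *)
Lemma proper_poincare :
  \sum_(p | pairs p) (f p.1 - f p.2) ^+ 2 <=
  (#|G| * #|G|.+1)%:R ^+ 2 * (N * spread ^+ b) * recolor_energy.
Proof.
have [ord ordP ordB] := path_decomposition_order bagsP.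
have Rge0 : 0 <= N * spread ^+ b * recolor_energy.
  rewrite mulr_ge0 ?mulr_ge0 ?exprn_ge0 // ?(le_trans ler01 spread_ge1) //.
  by apply: sumr_ge0 => u _; apply: sumr_ge0 => x _; apply: sumr_ge0 => c _; apply: sqr_ge0.
have Lle : (size (schedule ord ord))%:R <= (#|G| * #|G|.+1)%:R :> R.
  by rewrite ler_nat size_schedule.
apply: (@le_trans _ _ (\sum_(p | pairs p) (size (schedule ord ord))%:R *
    energy f p.2 (schedule ord ord) p.1)).
  apply: ler_sum => -[s t] /andP[/= sP tP]; apply: sqr_diff_le_energy => //.
  by apply: ensures_mono (ensures_schedule_end ordP tP sP) => y ->.
rewrite -big_distrr /= expr2 -!mulrA; apply: ler_pM => //.
  by apply: sumr_ge0 => p _; apply: energy_ge0.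
apply: le_trans (ler_wpM2r _ Lle); last by rewrite mulrA.
rewrite (mulrA N); apply: (@sum_energy_le _ _ _ _ _ _ _ [::]) => pre st post E.
exact: step_energy_sum_le E.
Qed.

End ProperPoincare.

(** * From a Poincare inequality to the mixing of a lazy symmetric chain *)

Section LazyChain.
Variables (R : realType) (T : finType) (Q : T -> T -> R).
Hypothesis Q_ge0 : forall s s', 0 <= Q s s'.
Hypothesis Q_sym : forall s s', Q s s' = Q s' s.
Hypothesis Q_row : forall s, \sum_s' Q s s' = 1.

(** A variance is nonnegative. *)
Lemma sqr_mean_le (w a : T -> R) : (forall s, 0 <= w s) -> \sum_s w s = 1 ->
  (\sum_s w s * a s) ^+ 2 <= \sum_s w s * a s ^+ 2.
Proof.
move=> w0 w1; set mu := \sum_s w s * a s.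
have : 0 <= \sum_s w s * (a s - mu) ^+ 2.
  by apply: sumr_ge0 => s _; rewrite mulr_ge0 ?sqr_ge0.
suff -> : \sum_s w s * (a s - mu) ^+ 2 = \sum_s w s * a s ^+ 2 - mu ^+ 2.
  by rewrite subr_ge0.
transitivity (\sum_s (w s * a s ^+ 2 - 2 * mu * (w s * a s) + w s * mu ^+ 2)).
  by apply: eq_bigr => s _; ring.
by rewrite !big_split /= sumrN -mulr_suml -mulr_sumr w1 -/mu; ring.
Qed.

Definition lazy (s s' : T) : R := 2^-1 * (s == s')%:R + 2^-1 * Q s s'.

Lemma sum_delta (s : T) (f : T -> R) : \sum_s' (s == s')%:R * f s' = f s.
Proof.
rewrite (bigD1 s) //= eqxx mul1r big1 ?addr0 // => s' /negbTE ss'.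
by rewrite eq_sym ss' mul0r.
Qed.

Lemma lazy_row s : \sum_s' lazy s s' = 1.
Proof.
rewrite big_split /= -!mulr_sumr Q_row.
under eq_bigr => s' _ do rewrite -[_%:R]mulr1.
by rewrite (sum_delta s (fun=> 1)); lra.
Qed.

Lemma lazy_sym s s' : lazy s s' = lazy s' s.
Proof. by rewrite /lazy eq_sym Q_sym. Qed.

Variable A : R.
Hypothesis A1 : 1 <= A.
Hypothesis poincare : forall f : T -> R,
  \sum_s \sum_s' (f s - f s') ^+ 2 <=
    A * #|T|%:R * \sum_s \sum_s' lazy s s' * (f s - f s') ^+ 2.

Let A_gt0 : 0 < A. Proof. exact: lt_le_trans A1. Qed.

Let gap_ge0 : 0 <= 1 - A^-1. Proof. by rewrite subr_ge0 invf_le1. Qed.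

(** No spectral theory is involved: the image is half of [f] plus half of [q], its squared norm is a
    quarter of [n2], half of [fq] and a quarter of the squared norm of [q]. The last is at most
    [n2], and the Poincare inequality reads [fq <= (1 - 2 / A) * n2]. *)
Lemma lazy_contracts (f : T -> R) : \sum_s f s = 0 ->
  \sum_s' (\sum_s f s * lazy s s') ^+ 2 <= (1 - A^-1) * \sum_s f s ^+ 2.
Proof.
move=> f0; have [T0|Tgt] := posnP #|T|.
  rewrite !big1 ?mulr0 // => s; by have := fintype0 s T0.
pose q s' := \sum_s f s * Q s s'.
pose n2 := \sum_s f s ^+ 2; pose fq := \sum_s f s * q s.
have qE s' : \sum_s f s * lazy s s' = 2^-1 * f s' + 2^-1 * q s'.
  rewrite -{1}(sum_delta s' f) !mulr_sumr -big_split /=; apply: eq_bigr => s _.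
  by rewrite /lazy eq_sym; ring.
have q2 : \sum_s' q s' ^+ 2 <= n2.
  apply: (@le_trans _ _ (\sum_s' \sum_s Q s s' * f s ^+ 2)).
    apply: ler_sum => s' _; rewrite /q; under eq_bigr => s _ do rewrite mulrC.
    apply: (@sqr_mean_le (Q^~ s') f) => //.
    by under eq_bigr => s _ do rewrite Q_sym.
  rewrite exchange_big; apply: ler_sum => s _.
  by rewrite -mulr_suml Q_row mul1r.
(* Used with [w = lazy] for the Dirichlet form and with [w = 1] for the variance. *)
have sum_sq (w : T -> T -> R) : (forall s s', w s s' = w s' s) ->
    \sum_s \sum_s' w s s' * (f s - f s') ^+ 2 =
    2 * (\sum_s f s ^+ 2 * \sum_s' w s s') - 2 * (\sum_s' f s' * \sum_s f s * w s s').
  move=> wsym.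
  transitivity (\sum_s \sum_s' (w s s' * f s ^+ 2 + w s s' * f s' ^+ 2
      - 2 * (f s' * (f s * w s s')))).
    by apply: eq_bigr => s _; apply: eq_bigr => s' _; ring.
  under eq_bigr => s _ do rewrite !big_split /= sumrN.
  rewrite !big_split /= sumrN [X in _ + X - _]exchange_big /=.
  have -> : \sum_s' \sum_s w s s' * f s' ^+ 2 = \sum_s f s ^+ 2 * \sum_s' w s s'.
    apply: eq_bigr => s _; rewrite mulr_sumr; apply: eq_bigr => s' _.
    by rewrite wsym mulrC.
  have -> : \sum_s \sum_s' w s s' * f s ^+ 2 = \sum_s f s ^+ 2 * \sum_s' w s s'.
    by apply: eq_bigr => s _; rewrite mulr_sumr; apply: eq_bigr => s' _; rewrite mulrC.
  have -> : \sum_s \sum_s' 2 * (f s' * (f s * w s s')) =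
      2 * (\sum_s' f s' * \sum_s f s * w s s').
    rewrite exchange_big mulr_sumr; apply: eq_bigr => s' _.
    by rewrite -mulr_sumr -mulr_sumr.
  by ring.
have E : \sum_s \sum_s' lazy s s' * (f s - f s') ^+ 2 = n2 - fq.
  rewrite (sum_sq lazy lazy_sym); under eq_bigr => s _ do rewrite lazy_row mulr1.
  under [X in _ - _ * X]eq_bigr => s' _ do rewrite qE.
  have -> : \sum_s f s * (2^-1 * f s + 2^-1 * q s) = 2^-1 * n2 + 2^-1 * fq.
    by rewrite !mulr_sumr -big_split /=; apply: eq_bigr => s _; ring.
  by rewrite -/n2; field.
have V : \sum_s \sum_s' (f s - f s') ^+ 2 = 2 * #|T|%:R * n2.
  have := sum_sq (fun _ _ => 1) (fun _ _ => erefl).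
  under eq_bigr => s _ do under eq_bigr => s' _ do rewrite mul1r.
  move=> ->; under [X in _ - _ * X]eq_bigr => s' _ do under eq_bigr do rewrite mulr1.
  under [X in _ - _ * X]eq_bigr => s' _ do rewrite f0 mulr0.
  rewrite [X in _ - _ * X]big1 // mulr0 subr0 sumr_const -mulr_suml -/n2.
  by rewrite mulrA mulrAC.
have := poincare f; rewrite V E => pf.
have {pf} : 2 * A^-1 * n2 <= n2 - fq.
  have Tgt' : 0 < #|T|%:R :> R by rewrite ltr0n.
  rewrite -(ler_pM2l A_gt0) -(ler_pM2r Tgt').
  have -> : A * (2 * A^-1 * n2) * #|T|%:R = 2 * #|T|%:R * n2.
    by field; rewrite gt_eqF.
  by apply: le_trans pf _; rewrite mulrAC.
under eq_bigr => s' _ do rewrite qE.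
have -> : \sum_s (2^-1 * f s + 2^-1 * q s) ^+ 2 =
    4^-1 * n2 + 2^-1 * fq + 4^-1 * \sum_s q s ^+ 2.
  by rewrite !mulr_sumr -!big_split /=; apply: eq_bigr => s _; field.
rewrite -/n2; lra.
Qed.

Variable law : nat -> T -> T -> R.
Hypothesis law0 : forall s s', law 0 s s' = (s == s')%:R.
Hypothesis lawS : forall t s s', law t.+1 s s' = \sum_z law t s z * lazy z s'.

Lemma law_row t s : \sum_s' law t s s' = 1.
Proof.
elim: t => [|t IH].
  under eq_bigr => s' _ do rewrite law0 -[_%:R]mulr1.
  exact: (sum_delta s (fun=> 1)).
under eq_bigr => s' _ do rewrite lawS.
rewrite exchange_big /= -[RHS]IH; apply: eq_bigr => z _.
by rewrite -mulr_sumr lazy_row mulr1.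
Qed.

(** The uniform law is stationary by symmetry, so the deviation from it has sum zero and is
    contracted at each step; initially its squared norm is [1 - #|T|%:R^-1]. *)
Lemma law_sqr_dist_le t s :
  \sum_s' (law t s s' - #|T|%:R^-1) ^+ 2 <= (1 - A^-1) ^+ t.
Proof.
have Tgt : 0 < #|T|%:R :> R by rewrite ltr0n; apply/card_gt0P; exists s.
elim: t => [|t IH].
  rewrite expr0.
  apply: (@le_trans _ _ (1 - #|T|%:R^-1)); last by rewrite lerBlDr lerDl invr_ge0.
  under eq_bigr => s' _ do rewrite law0.
  have -> : \sum_s' ((s == s')%:R - #|T|%:R^-1) ^+ 2 =
      \sum_s' ((s == s')%:R * (1 - 2 * #|T|%:R^-1) + #|T|%:R^-1 ^+ 2) :> R.
    by apply: eq_bigr => s' _; case: eqP => _ /=; ring.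
  rewrite big_split /= (sum_delta s (fun=> _)) sumr_const.
  rewrite -(mulr_natl (_ ^+ 2)) le_eqVlt; apply/orP; left; apply/eqP; field.
  by rewrite gt_eqF.
rewrite exprS; apply: le_trans (ler_wpM2l gap_ge0 IH).
apply: le_trans (lazy_contracts _); last first.
  by rewrite big_split /= law_row sumrN sumr_const -(mulr_natl #|T|%:R^-1) divff ?subrr // gt_eqF.
apply: ler_sum => s' _; rewrite lawS le_eqVlt; apply/orP; left; apply/eqP.
congr (_ ^+ 2); under [RHS]eq_bigr => z _ do rewrite mulrBl.
rewrite big_split /= sumrN -mulr_sumr.
by under [X in _ = _ - _ * X]eq_bigr => z _ do rewrite lazy_sym; rewrite lazy_row mulr1.
Qed.

(** Cauchy-Schwarz on each event, in the form of [sqr_mean_le] with uniform weights; this costs the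
    factor [#|T|%:R]. *)
Lemma dTV_law_le t s (d : R) : 0 <= d -> #|T|%:R * (1 - A^-1) ^+ t <= d ^+ 2 ->
  dTV (law t s) (uniform R predT) <= d.
Proof.
move=> d0 td; have Tgt : 0 < #|T|%:R :> R by rewrite ltr0n; apply/card_gt0P; exists s.
apply: bigmax_le => // S _.
rewrite -(ler_pXn2r (n := 2)) ?nnegrE // real_normK ?num_real //.
apply: le_trans td; apply: le_trans (ler_wpM2l (ltW Tgt) (law_sqr_dist_le t s)).
under [X in _ - X]eq_bigr => x _ do rewrite /uniform /=.
have TE : #|predT : pred T| = #|T| by apply: eq_card.
rewrite TE; pose g x : R := (x \in S)%:R * (law t s x - #|T|%:R^-1).
have := @sqr_mean_le (fun=> #|T|%:R^-1) g.
rewrite sumr_const -(mulr_natl #|T|%:R^-1) divff ?gt_eqF // => /(_ _ erefl).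
rewrite -!mulr_sumr exprMn => /(_ (fun=> _)).
rewrite invr_ge0 ltW // => /(_ isT) h.
have -> : \sum_(i in S) law t s i - \sum_(i in S) #|T|%:R^-1 = \sum_x g x.
  rewrite -sumrB big_mkcond; apply: eq_bigr => x _; rewrite /g.
  by case: ifP => _; rewrite ?mul1r ?mul0r.
apply: (@le_trans _ _ (#|T|%:R * \sum_x g x ^+ 2)).
  have T2 : 0 < #|T|%:R^-1 ^+ 2 :> R by rewrite exprn_gt0 ?invr_gt0.
  rewrite -(ler_pM2l T2); apply: le_trans h _.
  by rewrite mulrA expr2 mulfVK ?gt_eqF.
rewrite ler_pM2l //; apply: ler_sum => x _; rewrite /g.
by case: (x \in S); rewrite ?mul1r // mul0r expr0n sqr_ge0.
Qed.

Lemma dTV_law_le_time t s (d : R) : 0 < d ->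
  A * (ln #|T|%:R + 2 * ln d^-1) <= t%:R ->
  dTV (law t s) (uniform R predT) <= d.
Proof.
move=> d0 tA; apply: dTV_law_le (ltW d0) _.
have Tgt : 0 < #|T|%:R :> R by rewrite ltr0n; apply/card_gt0P; exists s.
have h : (1 - A^-1) ^+ t <= expR (- (t%:R / A)).
  rewrite mulrC -mulNr mulrC expRM_natl; apply: lerXn2r; rewrite ?nnegrE ?expR_ge0 //.
  exact: expR_ge1Dx.
apply: le_trans (ler_wpM2l (ltW Tgt) h) _.
rewrite -{1}(lnK (x := #|T|%:R)) ?posrE // -expRD.
rewrite -[X in _ <= X ^+ _](lnK (x := d)) ?posrE // -expRM_natl.
rewrite ler_expR; move: tA; rewrite lnV ?posrE // mulrC -ler_pdivlMr //.
lra.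
Qed.

End LazyChain.

Lemma ler_sum_inj (R : realType) (I J : finType) (j : I -> J) (P : pred J)
    (H : J -> R) : injective j -> (forall i, P (j i)) -> (forall y, 0 <= H y) ->
  \sum_i H (j i) <= \sum_(y | P y) H y.
Proof.
move=> j_inj Pj H0.
rewrite (bigID (fun y => y \in [set j i | i in I])) /= -[leLHS]addr0 lerD //.
  rewrite -(big_imset H (in2W j_inj)) /= le_eqVlt; apply/orP; left; apply/eqP.
  apply: eq_bigl => y; rewrite andbC; case: imsetP => //= -[i _ ->]; by rewrite Pj.
by apply: sumr_ge0.
Qed.

Lemma nat_minP (P : nat -> Prop) : (exists m, P m) -> P (nat_min P).
Proof.
move=> [m0 Pm0]; rewrite /nat_min; case: xgetP => [m -> []//|noP].
have exP : exists m, `[< P m >] by exists m0; apply/asboolP.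
case: (ex_minnP exP) => m /asboolP Pm mmin; case: (noP m); split=> // j Pj.
by apply: mmin; apply/asboolP.
Qed.

Lemma nat_min_le (P : nat -> Prop) m : P m -> (nat_min P <= m)%N.
Proof.
move=> Pm; rewrite /nat_min; case: xgetP => [n _ [_]|//]; exact.
Qed.

(** * The Single-Flaw chain: symmetry, repair of flaws, Poincare inequality *)

Section OmegaChain.
Variables (R : realType) (G : sgraph) (k : nat).
Hypothesis degk : (max_degree G + 2 <= k)%N.
Hypothesis G_gt0 : (0 < #|G|)%N.
Local Notation coloring := (coloring G k).
Local Notation states := (Omega G k).
Implicit Types (s : states) (v : G) (c : 'I_k).

(** The non-lazy half of the dynamics, chosen so that [lazy jump_prob] unfolds to
    [transition_prob]. *)
Definition jump_prob s s' : R :=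
  \sum_(v : G) \sum_(c < k) (#|G| * k)%:R^-1 * (next_state s v c == s')%:R.

Let nk_gt0 : 0 < (#|G| * k)%:R :> R.
Proof. by rewrite ltr0n muln_gt0 G_gt0; lia. Qed.

Lemma jump_prob_ge0 s s' : 0 <= jump_prob s s'.
Proof. by apply: sumr_ge0 => v _; apply: sumr_ge0 => c _; rewrite mulr_ge0. Qed.

Lemma jump_prob_row s : \sum_s' jump_prob s s' = 1.
Proof.
transitivity (\sum_(v : G) \sum_(c < k) (#|G| * k)%:R^-1 : R).
  rewrite exchange_big; apply: eq_bigr => v _ /=.
  rewrite exchange_big; apply: eq_bigr => c _ /=.
  rewrite -mulr_sumr -[RHS]mulr1; congr (_ * _).
  rewrite -[RHS](sum_delta (next_state s v c) (fun=> 1)).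
  by apply: eq_bigr => s' _; rewrite mulr1.
under eq_bigr => v _ do rewrite sumr_const card_ord.
by rewrite sumr_const -mulrnA mulnC -(mulr_natl (_^-1)) divff // gt_eqF // mulnC.
Qed.

Lemma val_next_state s v c :
  proper_coloring (recolor (val s) v c) || singly_flawed (recolor (val s) v c) ->
  val (next_state s v c) = recolor (val s) v c.
Proof. by move=> h; rewrite /next_state val_insubd h. Qed.

Lemma next_state_eq s s' v c : s != s' ->
  (next_state s v c == s') = (val s' == recolor (val s) v c).
Proof.
move=> ss'; rewrite -val_eqE /= eq_sym val_insubd; case: ifPn => // nO.
rewrite val_eqE eq_sym (negbTE ss'); apply/esym/eqP => E.
by have /= := valP s'; move: E => /= ->; rewrite (negbTE nO).
Qed.

Lemma recolor_eqP (x y : coloring) v c :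
  reflect ([/\ c = y v & forall w, w != v -> y w = x w]) (y == recolor x v c).
Proof.
apply: (iffP eqP) => [->|[-> h]].
  by split=> [|w /negbTE wv]; rewrite recolorE ?eqxx ?wv.
by apply/ffunP => w; rewrite recolorE; case: eqVneq => [->//|/h].
Qed.

(** Between distinct states, a vertex [v] contributes exactly one color if the states agree off [v]
    and none otherwise, a symmetric condition. *)
Lemma jump_prob_sym s s' : jump_prob s s' = jump_prob s' s.
Proof.
have [->//|ss'] := eqVneq s s'.
suff E (s1 s2 : states) v : s1 != s2 ->
    \sum_(c < k) (#|G| * k)%:R^-1 * (next_state s1 v c == s2)%:R =
    (#|G| * k)%:R^-1 * `[< forall w, w != v -> val s2 w = val s1 w >]%:R :> R.
  have s's : s' != s by rewrite eq_sym.
  apply: eq_bigr => v _; rewrite (E s s') // (E s' s) //; congr (_ * (nat_of_bool _)%:R).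
  by apply/asboolP/asboolP => h w wv; rewrite h.
move=> s12; rewrite -mulr_sumr (bigD1 (val s2 v)) //= big1 ?addr0 => [|c cne].
  rewrite next_state_eq //; congr (_ * (nat_of_bool _)%:R).
  by apply/recolor_eqP/asboolP => [[]//|h]; split.
rewrite next_state_eq //; case: recolor_eqP => // -[E _].
by rewrite E eqxx in cne.
Qed.

(** A singly-flawed coloring is proper off its flaw vertex, which has a free color. *)
Lemma repairable s : exists p : G * 'I_k, proper_coloring (recolor (val s) p.1 p.2).
Proof.
have [v0 _] : exists v0 : G, v0 \in G by apply/card_gt0P.
case/orP: (valP s) => [sP|/andP[_ /existsP[x /forallP sx]]].
  by exists (v0, val s v0); rewrite recolor_id.
have /card_gt0P[c cP] : (0 < #|free_colors (val s) x|)%N.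
  by apply: leq_trans (card_free_colors (val s) x); clear nk_gt0; lia.
exists (x, c) => /=; rewrite -proper_onT.
have -> : [set: G] = x |: ~: [set x] by rewrite finset.setUCr.
apply: recolor_free_proper_on => //; apply/proper_onP => u v.
rewrite !inE => ux vx uv; apply/negP => uveq.
have /forallP/(_ v) := sx u; rewrite /monochromatic uv uveq /=.
by rewrite ![x == _]eq_sym (negbTE ux) (negbTE vx).
Qed.

Definition repair_move s := xchoose (repairable s).

Definition repaired s : states :=
  next_state s (repair_move s).1 (repair_move s).2.

Lemma val_repaired s :
  val (repaired s) = recolor (val s) (repair_move s).1 (repair_move s).2.
Proof. by apply: val_next_state; rewrite (xchooseP (repairable s)). Qed.

Lemma repaired_proper s : proper_coloring (val (repaired s)).
Proof. by rewrite val_repaired (xchooseP (repairable s)). Qed.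

(** A state is recovered from its repair, the repaired vertex and the old color of that vertex, so
    the fibres have at most [#|G| * k] elements. *)
Lemma sum_repaired_le (h : coloring -> R) : (forall x, 0 <= h x) ->
  \sum_s h (val (repaired s)) <=
    (#|G| * k)%:R * \sum_(x : coloring | proper_coloring x) h x.
Proof.
move=> h0.
pose j s : coloring * (G * 'I_k) :=
  (val (repaired s), ((repair_move s).1, val s (repair_move s).1)).
have j_inj : injective j.
  move=> s s' E; apply: val_inj.
  have E1 : val (repaired s) = val (repaired s') := congr1 fst E.
  have E2 : (repair_move s).1 = (repair_move s').1 := congr1 (fun p => p.2.1) E.
  have E3 : val s (repair_move s).1 = val s' (repair_move s').1 :=
    congr1 (fun p => p.2.2) E.
  rewrite -[LHS](recolor_id _ (repair_move s).1).
  rewrite -(recolor_recolor _ _ (repair_move s).2) -val_repaired E1 E3 E2.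
  by rewrite val_repaired recolor_recolor recolor_id.
apply: le_trans (ler_sum_inj (P := fun y => proper_coloring y.1)
  (H := fun y => h y.1) j_inj _ _) _ => //.
  by move=> s; apply: repaired_proper.
have -> : \sum_(y : coloring * (G * 'I_k) | proper_coloring y.1) h y.1 =
    \sum_(x : coloring | proper_coloring x) \sum_(q : G * 'I_k) h x.
  by rewrite pair_big_dep; apply: eq_bigl => y; rewrite andbT.
rewrite mulr_sumr.
apply: ler_sum => x _; rewrite sumr_const card_prod card_ord mulr_natl.
by rewrite lexx.
Qed.

Lemma card_Omega_le :
  #|{: states}|%:R <=
    (#|G| * k)%:R * #|[set x | @proper_coloring G k x]|%:R :> R.
Proof.
have := @sum_repaired_le (fun=> 1) (fun=> ler01).
by rewrite !sumr_const cardsE.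
Qed.

Variable f : states -> R.

Definition next_energy : R :=
  \sum_s \sum_(v : G) \sum_(c < k) (f s - f (next_state s v c)) ^+ 2.

Lemma next_energyE : next_energy =
  2 * (#|G| * k)%:R * \sum_s \sum_s' lazy jump_prob s s' * (f s - f s') ^+ 2.
Proof.
rewrite /next_energy mulr_sumr; apply: eq_bigr => s _.
transitivity (\sum_(v : G) \sum_(c < k) \sum_s'
   (next_state s v c == s')%:R * (f s - f s') ^+ 2).
  by apply: eq_bigr => v _; apply: eq_bigr => c _; rewrite sum_delta.
under eq_bigr => v _ do rewrite exchange_big.
rewrite exchange_big mulr_sumr; apply: eq_bigr => s' _ /=.
have [->|ss'] := eqVneq s s'.
  rewrite subrr expr0n mulr0 mulr0 big1 // => v _.
  by rewrite big1 // => c _; rewrite mulr0.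
rewrite /lazy (negbTE ss') mulr0 add0r /jump_prob.
under eq_bigr => v _ do rewrite -mulr_suml.
rewrite -mulr_suml mulrA; congr (_ * _).
under [in RHS]eq_bigr => v _ do rewrite -mulr_sumr.
rewrite -mulr_sumr; move: (#|G| * k)%:R nk_gt0 => M M0; field.
by rewrite gt_eqF.
Qed.

(** Extends [f] to all colorings with the default 0; the sums below evaluate it at states. *)
Let F (x : coloring) : R := if insub x is Some s then f s else 0.

Let F_val s : F (val s) = f s. Proof. by rewrite /F valK. Qed.

Lemma recolor_energy_le : recolor_energy F <= next_energy.
Proof.
rewrite /next_energy exchange_big; apply: ler_sum => v _ /=.
pose h x := \sum_(c < k | proper_coloring (recolor x v c)) (F x - F (recolor x v c)) ^+ 2.
have h0 x : 0 <= h x by apply: sumr_ge0 => c _; apply: sqr_ge0.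
apply: (@le_trans _ _ (\sum_s h (val s))).
  rewrite [leLHS]big_mkcond (bigID (fun x => x \in [set val s | s : states])) /=.
  rewrite [X in _ + X]big1 ?addr0 => [|x xO]; last first.
    case: ifP => // xP; case/negP: xO.
    have xO : proper_coloring x || singly_flawed x by rewrite xP.
    by apply/imsetP; exists (exist _ x xO).
  rewrite big_imset => [|? ? _ _]; last exact: val_inj.
  by apply: ler_sum => s _; case: ifP.
apply: ler_sum => s _; rewrite /h big_mkcond; apply: ler_sum => c _.
case: ifP => [cP|_]; last exact: sqr_ge0.
by rewrite -val_next_state ?cP // !F_val.
Qed.

Lemma sum_repaired_sqr_le : \sum_s (f s - f (repaired s)) ^+ 2 <= next_energy.
Proof.
apply: ler_sum => s _.
rewrite (bigD1 (repair_move s).1) //= (bigD1 (repair_move s).2) //= -addrA lerDl.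
by rewrite addr_ge0 ?sumr_ge0 // => *; rewrite ?sumr_ge0 // => *; rewrite sqr_ge0.
Qed.

Variables (bags : seq {set G}) (b : nat).
Hypothesis bagsP : path_decomposition bags.
Hypothesis bagsb : {in bags, forall X : {set G}, (#|X| <= b)%N}.

(** The 6 is 3, for the square of a sum of three terms, times the 2 of laziness. Inside, 2 counts
    the two repairs; the other term is the constant of [proper_poincare] times the fibre size
    [#|G| * k] at both ends. *)
Definition relaxation_bound : R :=
  6 * (#|G| * k)%:R *
  (2 + (#|G| * k)%:R ^+ 2 * (#|G| * #|G|.+1)%:R ^+ 2 * spread R G k ^+ b).

(** Two states are joined by repairing both and linking the repaired colorings through proper ones.
    A repair is a single move of the chain. *)
Lemma Omega_poincare :
  \sum_s \sum_s' (f s - f s') ^+ 2 <= relaxation_bound * #|{: states}|%:R *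
    \sum_s \sum_s' lazy jump_prob s s' * (f s - f s') ^+ 2.
Proof.
set E := \sum_s \sum_s' lazy _ s s' * _.
have S0 : 0 <= next_energy.
  by do 3?(apply: sumr_ge0 => ? _); apply: sqr_ge0.
have W0 : 0 <= #|{: states}|%:R :> R by [].
have h1 : \sum_s \sum_(s' : states) (f s - f (repaired s)) ^+ 2 <= #|{: states}|%:R * next_energy.
  apply: (@le_trans _ _ (#|{: states}|%:R * \sum_s (f s - f (repaired s)) ^+ 2)).
    rewrite mulr_sumr; apply: ler_sum => s _.
    by rewrite sumr_const mulr_natl.
  by rewrite ler_wpM2l // sum_repaired_sqr_le.
have h3 : \sum_(s : states) \sum_s' (f s' - f (repaired s')) ^+ 2 <= #|{: states}|%:R * next_energy.
  by rewrite exchange_big.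
have h2 : \sum_s \sum_s' (f (repaired s) - f (repaired s')) ^+ 2 <=
    (#|G| * k)%:R ^+ 2 * ((#|G| * #|G|.+1)%:R ^+ 2 *
    (#|{: states}|%:R * spread R G k ^+ b) * next_energy).
  apply: (@le_trans _ _ (\sum_s (#|G| * k)%:R *
      \sum_(y : coloring | proper_coloring y) (F (val (repaired s)) - F y) ^+ 2)).
    apply: ler_sum => s _.
    have := @sum_repaired_le (fun y => (F (val (repaired s)) - F y) ^+ 2).
    move=> /(_ (fun=> sqr_ge0 _)); apply: le_trans.
    by apply: ler_sum => s' _; rewrite !F_val.
  rewrite -mulr_sumr expr2 -mulrA ler_wpM2l ?ler0n //.
  apply: le_trans (@sum_repaired_le (fun x =>
    \sum_(y : coloring | proper_coloring y) (F x - F y) ^+ 2) _) _.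
    by move=> x; apply: sumr_ge0 => y _; apply: sqr_ge0.
  rewrite ler_wpM2l ?ler0n // pair_big_dep.
  apply: le_trans (proper_poincare degk F bagsP bagsb) _.
  have sp : 0 <= spread R G k by rewrite (le_trans ler01) // spread_ge1.
  have sp0 : 0 <= spread R G k ^+ b by rewrite exprn_ge0.
  apply: ler_pM (recolor_energy_le) => //.
  - by rewrite !mulr_ge0 ?exprn_ge0.
  - by do 3?(apply: sumr_ge0 => ? _); apply: sqr_ge0.
  (* Proper colorings are states, so their number is at most that of the states. *)
  rewrite ler_wpM2l ?exprn_ge0 // ler_wpM2r // ler_nat.
  apply: leq_trans (leq_imset_card val {: states}).
  apply/subset_leq_card/fintype.subsetP => x; rewrite inE => xP.
  have xO : proper_coloring x || singly_flawed x by rewrite xP.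
  by apply/imsetP; exists (exist _ x xO).
apply: (@le_trans _ _ (3 * (\sum_s \sum_(s' : states) (f s - f (repaired s)) ^+ 2 +
   \sum_s \sum_s' (f (repaired s) - f (repaired s')) ^+ 2 +
   \sum_(s : states) \sum_s' (f s' - f (repaired s')) ^+ 2))).
  rewrite -!big_split /= mulr_sumr; apply: ler_sum => s _.
  rewrite -!big_split /= mulr_sumr; apply: ler_sum => s' _.
  move: (f (repaired s)) (f (repaired s')) (f s) (f s') => r t p q.
  have h4 := sqr_ge0 ((p - r) - (r - t)); have h5 := sqr_ge0 ((p - r) - (t - q)).
  have h6 := sqr_ge0 ((r - t) - (t - q)). lra.
apply: (@le_trans _ _ (relaxation_bound * #|{: states}|%:R *
    (next_energy / (2 * (#|G| * k)%:R)))); last first.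
  rewrite next_energyE -/E -[X in _ * X <= _]mulrC mulKf //.
  by rewrite gt_eqF ?mulr_gt0.
have -> : relaxation_bound * #|{: states}|%:R * (next_energy / (2 * (#|G| * k)%:R)) =
  3 * (#|{: states}|%:R * next_energy +
    (#|G| * k)%:R ^+ 2 * ((#|G| * #|G|.+1)%:R ^+ 2 *
    (#|{: states}|%:R * spread R G k ^+ b) * next_energy) +
    #|{: states}|%:R * next_energy).
  rewrite /relaxation_bound; move: (#|G| * k)%:R nk_gt0 => M M0.
  move: (#|G| * #|G|.+1)%:R => L; field.
  by rewrite gt_eqF.
by rewrite ler_pM2l // !lerD.
Qed.

End OmegaChain.

(** Shows that [pathwidth] is a genuine minimum, and gives mixing without any assumption on the
    pathwidth. *)
Lemma trivial_path_decomposition (G : sgraph) :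
  path_decomposition [:: [set: G]].
Proof.
split=> [v|u v _|i j l ij jl]; [by exists [set: G]; rewrite ?inE|by exists [set: G]; rewrite ?inE|].
rewrite ltnS leqn0 => /eqP l0; move: jl ij; rewrite l0 leqn0 => /eqP->.
by rewrite leqn0 => /eqP->; rewrite finset.setIid.
Qed.

Lemma ln_nat_ge0 (R : realType) (m : nat) : 0 <= ln (m%:R : R).
Proof. by case: m => [|m]; [rewrite ln0|rewrite ln_ge0 // ler1n]. Qed.

(** * Mixing time of the Single-Flaw dynamics *)

Section MixingTime.
Variables (R : realType) (G : sgraph) (k : nat).
Hypothesis degk : (max_degree G + 2 <= k)%N.
Hypothesis G_gt0 : (0 < #|G|)%N.
Local Notation states := (Omega G k).
Implicit Types s : states.

Let k_gt0 : (0 < k)%N. Proof. by lia. Qed.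

Lemma law_after0 s s' : law_after R 0 s s' = (s == s')%:R.
Proof. by rewrite /law_after expr0 mxE (inj_eq enum_rank_inj). Qed.

Lemma law_afterS t s s' :
  law_after R t.+1 s s' = \sum_z law_after R t s z * lazy (@jump_prob R G k) z s'.
Proof.
rewrite /law_after exprSr mxE (reindex _ (onW_bij _ (enum_rank_bij _))) /=.
by apply: eq_bigr => z _; rewrite [transition_matrix _ _ _ _ _]mxE !enum_rankK.
Qed.

Lemma law_after_ge0 t s s' : 0 <= law_after R t s s'.
Proof.
elim: t s' => [|t IH] s'; first by rewrite law_after0.
rewrite law_afterS; apply: sumr_ge0 => z _; apply: mulr_ge0 => //.
by rewrite addr_ge0 ?mulr_ge0 ?jump_prob_ge0.
Qed.

Lemma law_after_row t s : \sum_s' law_after R t s s' = 1.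
Proof.
apply: (law_row (Q := @jump_prob R G k)); first exact: jump_prob_row.
  exact: law_after0.
exact: law_afterS.
Qed.

Lemma relaxation_bound_ge1 b : 1 <= relaxation_bound R G k b.
Proof.
have nk1 : 1 <= (#|G| * k)%:R :> R by rewrite ler1n muln_gt0 G_gt0.
have sp : 0 <= (#|G| * k)%:R ^+ 2 * (#|G| * #|G|.+1)%:R ^+ 2 * spread R G k ^+ b.
  by rewrite !mulr_ge0 ?exprn_ge0 // (le_trans ler01) // spread_ge1.
rewrite /relaxation_bound; nra.
Qed.

Section Decomposition.
Variables (bags : seq {set G}) (b : nat).
Hypothesis bagsP : path_decomposition bags.
Hypothesis bagsb : {in bags, forall X : {set G}, (#|X| <= b)%N}.

Lemma dTV_law_after_le t s (d : R) : 0 < d ->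
  relaxation_bound R G k b * (ln #|{: states}|%:R + 2 * ln d^-1) <= t%:R ->
  dTV (law_after R t s) (uniform R predT) <= d.
Proof.
apply: dTV_law_le_time.
- exact: jump_prob_ge0.
- exact: jump_prob_sym.
- exact: jump_prob_row.
- exact: relaxation_bound_ge1.
- by move=> f; apply: (Omega_poincare degk G_gt0 f bagsP bagsb).
- exact: law_after0.
- exact: law_afterS.
Qed.

Lemma mixing_time_le (d : R) : 0 < d <= 1 ->
  (mixing_time G k d)%:R <=
    relaxation_bound R G k b * (ln #|{: states}|%:R + 2 * ln d^-1) + 1.
Proof.
move=> /andP[d0 d1]; set X := _ * (_ + _).
have X0 : 0 <= X.
  apply: mulr_ge0; first by apply: le_trans (relaxation_bound_ge1 b).
  by rewrite addr_ge0 ?ln_nat_ge0 // mulr_ge0 // ln_ge0 // invf_ge1.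
have cX : 0 <= Num.ceil X by rewrite ceil_ge0; apply: lt_le_trans X0; rewrite ltrN10.
have absX : (`|Num.ceil X|%N)%:R = (Num.ceil X)%:~R :> R.
  by rewrite -[in RHS](gez0_abs cX).
apply: (@le_trans _ _ (`|Num.ceil X|%N)%:R); last first.
  by rewrite absX; have := ceilB1_lt X; rewrite intrB; lra.
rewrite ler_nat; apply/bigmax_leqP => s _.
apply: nat_min_le => t ct; apply: dTV_law_after_le => //.
apply: (@le_trans _ _ (`|Num.ceil X|%N)%:R); last by rewrite ler_nat.
by rewrite absX ceil_ge.
Qed.

End Decomposition.

(** The single-bag decomposition provides some finite mixing bound, so the minimum defining the
    mixing time is attained and is not the default 0. *)
Lemma mixing_timeP (d : R) t s : 0 < d -> (mixing_time G k d <= t)%N ->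
  dTV (law_after R t s) (uniform R predT) <= d.
Proof.
move=> d0 dt.
have bagsP := trivial_path_decomposition G.
have bagsb : {in [:: [set: G]], forall X : {set G}, (#|X| <= #|G|)%N}.
  by move=> X _; apply: max_card.
pose P t0 := forall t, (t0 <= t)%N -> dTV (law_after R t s) (uniform R predT) <= d.
have /nat_minP : exists t0, P t0.
  exists `|Num.ceil (relaxation_bound R G k #|G| * (ln #|{: states}|%:R + 2 * ln d^-1))|%N.
  move=> t' tt'; apply: (dTV_law_after_le bagsP bagsb) => //.
  apply: le_trans (ceil_ge _) _; rewrite (le_trans (ler_norm _)) //.
  by rewrite -intr_norm -abszE -pmulrn ler_nat.
by apply; apply: leq_trans dt; apply: (leq_bigmax s).
Qed.

End MixingTime.

(** * Output distribution of the sampler *)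

Section Sampler.
Variables (R : realType) (G : sgraph) (k : nat).
Hypothesis degk : (max_degree G + 2 <= k)%N.
Hypothesis G_gt0 : (0 < #|G|)%N.
Local Notation prog := (prog G k).
Local Notation coloring := (coloring G k).
Local Notation states := (Omega G k).

Lemma final_prob_ge0 A (p : prog A) s t : 0 <= final_prob R p s t.
Proof.
elim: p s => //= [q IH|q IH|q IH] s; apply: sumr_ge0 => x _;
  by rewrite mulr_ge0 ?invr_ge0.
Qed.

Lemma final_prob_sum A (p : prog A) s : \sum_t final_prob R p s t = 1.
Proof.
have k_gt0 : (0 < k)%N by lia.
have avg (I : finType) (F : I -> coloring -> R) : (0 < #|I|)%N ->
    (forall i, \sum_t F i t = 1) -> \sum_t \sum_i #|I|%:R^-1 * F i t = 1.
  move=> I0 F1; rewrite exchange_big /=.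
  under eq_bigr => i _ do rewrite -mulr_sumr F1 mulr1.
  by rewrite sumr_const -(mulr_natl (_^-1)) divff // pnatr_eq0 -lt0n.
elim: p s => //= [a|q IH|q IH|q IH] s.
- rewrite -[RHS](sum_delta s (fun=> 1)).
  by apply: eq_bigr => t _; rewrite mulr1.
- by have := avg _ (fun b => final_prob R (q b) s); rewrite card_bool; apply.
- exact: avg.
- by have := avg _ (fun c => final_prob R (q c) s); rewrite card_ord; apply.
Qed.

Lemma final_prob_bind A (p : prog unit) (f : unit -> prog A) s t :
  final_prob R (bind p f) s t =
  \sum_s' final_prob R p s s' * final_prob R (f tt) s' t.
Proof.
have avg (I : finType) (w : R) (F : I -> coloring -> R) (H : coloring -> R) :
    \sum_i w * (\sum_s' F i s' * H s') = \sum_s' (\sum_i w * F i s') * H s'.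
  under [RHS]eq_bigr => s' _ do rewrite mulr_suml.
  rewrite exchange_big; apply: eq_bigr => i _ /=; rewrite mulr_sumr.
  by apply: eq_bigr => s' _; rewrite mulrA.
elim: p s => //= [[]|q IH|q IH|q IH] s; first by rewrite sum_delta.
- by under eq_bigr => b _ do rewrite IH; rewrite avg.
- by under eq_bigr => v _ do rewrite IH; rewrite avg.
- by under eq_bigr => c _ do rewrite IH; rewrite avg.
Qed.

Lemma law_afterSl t (s s' : states) :
  law_after R t.+1 s s' = \sum_z lazy (@jump_prob R G k) s z * law_after R t z s'.
Proof.
rewrite /law_after exprS mxE (reindex _ (onW_bij _ (enum_rank_bij _))) /=.
by apply: eq_bigr => z _; rewrite [transition_matrix _ _ _ _ _]mxE !enum_rankK.
Qed.

Lemma single_flaw_step_bindE (s : states) (f : unit -> prog unit) t :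
  final_prob R (bind (single_flaw_step G k) f) (val s) t =
  \sum_z lazy (@jump_prob R G k) s z * final_prob R (f tt) (val z) t.
Proof.
rewrite single_flaw_step_bind.
under [RHS]eq_bigr => z _ do rewrite mulrDl -!mulrA.
rewrite big_split /= -!mulr_sumr; congr (_ * _ + _ * _).
  by rewrite (sum_delta s (fun z => final_prob R (f tt) (val z) t)).
under [RHS]eq_bigr => z _ do rewrite mulr_suml.
rewrite [RHS]exchange_big; apply: eq_bigr => v _ /=.
under [RHS]eq_bigr => z _ do rewrite mulr_suml.
rewrite [RHS]exchange_big; apply: eq_bigr => c _ /=.
under [RHS]eq_bigr => z _ do rewrite -mulrA.
by rewrite -mulr_sumr (sum_delta _ (fun z => final_prob R (f tt) (val z) t)).
Qed.

Lemma repeat_step_bindE m (s : states) (f : unit -> prog unit) t :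
  final_prob R (bind (repeat m (single_flaw_step G k)) f) (val s) t =
  \sum_z law_after R m s z * final_prob R (f tt) (val z) t.
Proof.
elim: m s => [|m IH] s.
  under eq_bigr => z _ do rewrite law_after0.
  by rewrite (sum_delta s (fun z => final_prob R (f tt) (val z) t)).
rewrite -[LHS]/(final_prob R (bind (bind (single_flaw_step G k)
  (fun=> repeat m (single_flaw_step G k))) f) (val s) t) bindA single_flaw_step_bindE.
under eq_bigr => z _ do rewrite IH mulr_sumr.
rewrite exchange_big; apply: eq_bigr => z' _ /=.
by rewrite law_afterSl mulr_suml; apply: eq_bigr => z _; rewrite mulrA.
Qed.

Variables (start : prog unit).
Hypothesis startP : finds_proper R start.

(** Allows the memory left by [start] to be treated as a state of the chain. *)
Lemma start_supported (F F' : coloring -> R) s :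
  (forall z : states, proper_coloring (val z) -> F (val z) = F' (val z)) ->
  \sum_a final_prob R start s a * F a = \sum_a final_prob R start s a * F' a.
Proof.
move=> FF'; apply: eq_bigr => a _.
have [->|/startP aP] := eqVneq (final_prob R start s a) 0; first by rewrite !mul0r.
have aO : proper_coloring a || singly_flawed a by rewrite aP.
by have /= -> := FF' (exist _ a aO) aP.
Qed.

Variable tau : nat.

(** One round of the loop; [z0] is the value of [insubd] at colorings outside [Omega], which [start]
    never leaves. *)
Lemma attemptsSE T s (z0 : states) (S : {set coloring}) :
  let H (z : states) := if proper_coloring (val z) then (val z \in S)%:R
    else \sum_(t in S) final_prob R (attempts start tau T) (val z) t in
  \sum_(t in S) final_prob R (attempts start tau T.+1) s t =
  \sum_a final_prob R start s a * (\sum_z law_after R tau (insubd z0 a) z * H z).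
Proof.
move=> H; under eq_bigr => t _.
  rewrite -[final_prob _ _ _ _]/(final_prob R (bind start (fun=>
    bind (repeat tau (single_flaw_step G k)) (fun=>
    bind (proper_prog G k) (fun b =>
      if b then Ret tt else attempts start tau T)))) s t) final_prob_bind; over.
rewrite exchange_big /=.
under eq_bigr => a _ do rewrite -mulr_sumr.
apply: start_supported => z zP; rewrite valKd; cbv beta.
transitivity (\sum_(t in S) \sum_y law_after R tau z y *
    final_prob R (bind (proper_prog G k) (fun b =>
      if b then Ret tt else attempts start tau T)) (val y) t).
  by apply: eq_bigr => t _; apply: (repeat_step_bindE tau z).
rewrite exchange_big /=; apply: eq_bigr => y _; rewrite -mulr_sumr; congr (_ * _).
under eq_bigr => t _ do rewrite yields_proper.
rewrite /H; case: ifP => //= yP; rewrite big_mkcond.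
have [yS|yS] := boolP (val y \in S).
  rewrite (bigD1 (val y)) //= yS eqxx big1 ?addr0 // => t /negbTE ty.
  by rewrite eq_sym ty; case: ifP.
by rewrite big1 // => t _; case: ifP => // tS; case: eqP => // E; move: yS => /=; rewrite E tS.
Qed.

Lemma attempts_proper T s (z0 : states) :
  \sum_(t | proper_coloring t) final_prob R (attempts start tau T) s t = 1.
Proof.
pose P := [set t | @proper_coloring G k t].
suff E T' s' : \sum_(t in P) final_prob R (attempts start tau T') s' t = 1.
  by rewrite -[RHS](E T s); apply: eq_bigl => t; rewrite inE.
elim: T' s' => [|T' IH] s'.
  rewrite /= -[RHS](final_prob_sum start s') [LHS]big_mkcond.
  apply: eq_bigr => t _; rewrite inE; case: ifPn => // tP.
  by apply/esym/eqP; apply: contraNT tP => /startP.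
rewrite (attemptsSE _ _ z0) -[RHS](final_prob_sum start s').
apply: eq_bigr => a _; rewrite -[RHS]mulr1; congr (_ * _).
rewrite -[RHS](law_after_row R degk G_gt0 tau (insubd z0 a)).
apply: eq_bigr => z _; case: ifP => zP; first by rewrite inE zP mulr1.
by rewrite IH mulr1.
Qed.

Variable d : R.
Hypothesis mixed : forall s : states, dTV (law_after R tau s) (uniform R predT) <= d.

Let N : R := (k * #|G| + 1)%:R.

Let P := [set t | @proper_coloring G k t].

Let mixed_on (s : states) (A : {set states}) :
  `|\sum_(z in A) law_after R tau s z - #|A|%:R / #|{: states}|%:R| <= d.
Proof.
apply: le_trans (mixed s); apply: le_trans; last first.
  exact: (le_bigmax _ _ A).
rewrite le_eqVlt; apply/orP; left; apply/eqP; congr (`|_ - _|).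
under eq_bigr => z _ do rewrite /uniform /=.
by rewrite sumr_const -(mulr_natl (_^-1)).
Qed.

(** The bound solves [e_0 = 1], [e_(T+1) = 2 d + q e_T]: a successful round contributes at most
    [2 d], and a round fails with probability at most [q], after which the induction hypothesis
    applies to whatever memory is left. *)
Lemma attempts_error T s (z0 : states) (S : {set coloring}) :
  `|\sum_(t in S) final_prob R (attempts start tau T) s t -
    \sum_(t in S) uniform R (@proper_coloring G k) t| <=
  2 * d * (\sum_(i < T) (1 - N^-1 + d) ^+ i) + (1 - N^-1 + d) ^+ T.
Proof.
set q := 1 - _ + _; set U := \sum_(t in S) uniform _ _ t.
pose AP := [set z : states | proper_coloring (val z)].
pose AS := [set z in AP | val z \in S].
have cardA (B : {set coloring}) :
    #|[set z in AP | val z \in B]| = #|P :&: B|.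
  rewrite -(card_imset _ val_inj); apply: eq_card => x; rewrite !inE.
  apply/imsetP/andP => [[z]|[xP xB]]; first by rewrite !inE => /andP[? ?] ->.
  have xO : proper_coloring x || singly_flawed x by rewrite xP.
  by exists (exist _ x xO); rewrite // !inE xP.
have P_gt0 : 0 < #|P|%:R :> R.
  by rewrite ltr0n; apply/card_gt0P; exists (val (repaired degk G_gt0 z0));
     rewrite inE repaired_proper.
have O_gt0 : 0 < #|{: states}|%:R :> R by rewrite ltr0n; apply/card_gt0P; exists z0.
have UE : U = #|P :&: S|%:R / #|P|%:R.
  rewrite /U /uniform -big_mkcondr /= sumr_const -(mulr_natl (_^-1)).
  congr (_%:R / _%:R); first by apply: eq_card => x; rewrite !inE andbC.
  by apply: eq_card => x; rewrite inE.
have U01 : 0 <= U <= 1.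
  rewrite UE divr_ge0 // ler_pdivrMr // mul1r ler_nat.
  by rewrite subset_leq_card // finset.subsetIl.
have APE : #|AP| = #|P|.
  have := cardA [set: coloring]; rewrite finset.setIT => <-.
  by apply: eq_card => z; rewrite !inE andbT.
have rho : N^-1 <= #|AP|%:R / #|{: states}|%:R.
  have N0 : 0 < N by rewrite ltr0n addn1.
  rewrite ler_pdivlMr // ler_pdivrMl // APE.
  apply: le_trans (card_Omega_le R degk G_gt0) _.
  by rewrite ler_wpM2r // ler_nat [(k * _)%N]mulnC leq_addr.
have d0 : 0 <= d by apply: le_trans (mixed_on z0 AP); apply: normr_ge0.
elim: T s => [|T IH] s.
  rewrite big_ord0 mulr0 add0r expr0.
  have D0 : 0 <= \sum_(t in S) final_prob R (attempts start tau 0) s t <= 1.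
    rewrite sumr_ge0 => [|t _]; last exact: final_prob_ge0.
    rewrite -(final_prob_sum (attempts start tau 0) s) [leRHS](bigID (mem S)) /= lerDl.
    by apply: sumr_ge0 => t _; apply: final_prob_ge0.
  by move: U01 D0; rewrite ler_norml => /andP[? ?] /andP[? ?]; lra.
have eE : 2 * d * (\sum_(i < T.+1) q ^+ i) + q ^+ T.+1 =
    2 * d + q * (2 * d * (\sum_(i < T) q ^+ i) + q ^+ T).
  rewrite big_ord_recl expr0 exprS.
  under eq_bigr => i _ do rewrite lift0 exprS.
  by rewrite -mulr_sumr; ring.
rewrite eE; move: IH; set e := 2 * d * _ + _ => IH.
rewrite (attemptsSE _ _ z0) -[U]mul1r -[Z in _ - Z * _](final_prob_sum start s) mulr_suml.
rewrite -sumrB; under eq_bigr => a _ do rewrite -mulrBr.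
apply: le_trans (ler_norm_sum _ _ _) _.
rewrite -[leRHS]mul1r -[Z in _ <= Z * _](final_prob_sum start s) mulr_suml; apply: ler_sum => a _.
rewrite normrM ger0_norm ?final_prob_ge0 // ler_wpM2l ?final_prob_ge0 //.
move: (insubd z0 a) => {a} z; set mu := law_after R tau z.
have mu1 : \sum_y mu y = 1 by exact: law_after_row.
have mu0 y : 0 <= mu y by exact: law_after_ge0.
pose D (y : states) : R := \sum_(t in S) final_prob R (attempts start tau T) (val y) t.
have e0 : 0 <= e by apply: le_trans (IH s); apply: normr_ge0.
pose X : R := \sum_y mu y * (if proper_coloring (val y) then (val y \in S)%:R else D y).
suff : `|X - U| <= 2 * d + q * e by [].
(* Under the stationary law the mass of [AS] is [U] times that of [AP], so only deviations of [mu]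
   from it remain, besides the failed rounds. *)
have -> : X - U = ((\sum_(y in AS) mu y - #|AS|%:R / #|{: states}|%:R) -
      U * (\sum_(y in AP) mu y - #|AP|%:R / #|{: states}|%:R)) +
    \sum_(y in ~: AP) mu y * (D y - U).
  have -> : #|AS|%:R / #|{: states}|%:R = U * (#|AP|%:R / #|{: states}|%:R).
    by rewrite UE APE /AS cardA mulrA mulfVK // gt_eqF.
  rewrite /X -[Z in _ - Z = _]mul1r -[Z in _ - Z * _ = _]mu1 mulr_suml -sumrB.
  have -> : \sum_(y in AS) mu y = \sum_(y in AP) mu y * (val y \in S)%:R.
    rewrite [LHS]big_mkcond [RHS]big_mkcond; apply: eq_bigr => y _.
    by rewrite !inE; case: (proper_coloring _) => //=; case: (_ \in S);
       rewrite ?mulr1 ?mulr0.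
  rewrite (bigID (mem AP)) /=.
  rewrite (eq_bigr (fun y => mu y * (val y \in S)%:R - mu y * U)); last first.
    by move=> y; rewrite inE => ->.
  rewrite sumrB -mulr_suml.
  rewrite [X in _ + X = _](eq_bigr (fun y => mu y * (D y - U))); last first.
    by move=> y; rewrite inE => /negbTE->; rewrite mulrBr.
  rewrite [X in _ + X = _](eq_bigl (mem (~: AP))); last by move=> y; rewrite /= !inE.
  by ring.
apply: le_trans (ler_normD _ _) _; apply: lerD.
  apply: le_trans (ler_normB _ _) _; have := mixed_on z AS; have := mixed_on z AP.
  rewrite -/mu normrM; case/andP: U01 => U0 U1; rewrite (ger0_norm U0).
  move: (`|_|) (`|_|) (normr_ge0 (\sum_(y in AP) mu y - #|AP|%:R / #|{: states}|%:R)).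
  move=> x y; nra.
apply: le_trans (ler_norm_sum _ _ _) _.
apply: (@le_trans _ _ (\sum_(y in ~: AP) mu y * e)).
  by apply: ler_sum => y _; rewrite normrM ger0_norm // ler_wpM2l //; apply: IH.
rewrite -mulr_suml ler_wpM2r //.
(* The failure probability: [AP] has stationary mass at least [N^-1], and [mu] differs from it by at
   most [d]. *)
have -> : \sum_(y in ~: AP) mu y = 1 - \sum_(y in AP) mu y.
  rewrite -mu1 [Z in _ = Z - _](bigID (mem AP)) /= addrAC subrr add0r.
  by apply: eq_bigl => y; rewrite finset.in_setC.
have := mixed_on z AP; rewrite ler_norml -/mu /q => /andP[? _]; lra.
Qed.

End Sampler.

Lemma max_degree_lt_card (G : sgraph) : (0 < #|G|)%N -> (max_degree G < #|G|)%N.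
Proof.
move=> G0; rewrite -(prednK G0) ltnS; apply/bigmax_leqP => v _.
rewrite -(cardsC1 v); apply/subset_leq_card/fintype.subsetP => w.
by rewrite !inE; apply: contraTneq => ->; rewrite edge_irrefl.
Qed.

Lemma max_degree_gt0_card (G : sgraph) : (0 < max_degree G)%N -> (1 < #|G|)%N.
Proof.
have [G0|G0 d0] := posnP #|G|; last exact: leq_trans (max_degree_lt_card G0).
by rewrite /max_degree big_pred0 // => v; have := fintype0 v G0.
Qed.

(** Both terms are at most [delta / 3]. The geometric sum gives [2 * delta / (N - delta)], whence
    [7 <= N]; the power is at most the exponential of [- T * (1 - q)], and
    [(N + 1) ^+ 2 * (1 - q) >= 1]. *)
Lemma error_bound (R : realType) (N delta : R) (T : nat) :
  7 <= N -> 0 < delta < 1 -> ln (3 / delta) * (N + 1) ^+ 2 <= T%:R ->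
  2 * (delta / N ^+ 2) * (\sum_(i < T) (1 - N^-1 + delta / N ^+ 2) ^+ i) +
    (1 - N^-1 + delta / N ^+ 2) ^+ T <= delta.
Proof.
move=> N7 /andP[d0 d1] hT; set d := delta / N ^+ 2; set q := 1 - N^-1 + d.
have N0 : 0 < N by lra.
have qE : 1 - q = (N - delta) / N ^+ 2 by rewrite /q /d; field; rewrite gt_eqF.
have N2 : 0 < N ^+ 2 by rewrite exprn_gt0.
have q1 : 0 < 1 - q by rewrite qE divr_gt0 //; lra.
have q0 : 0 <= q.
  have : N^-1 <= 1 by rewrite invf_le1 //; lra.
  have : 0 <= d by rewrite divr_ge0 // ltW.
  by rewrite /q; lra.
have geo : (1 - q) * (\sum_(i < T) q ^+ i) <= 1.
  have -> : (1 - q) * (\sum_(i < T) q ^+ i) = 1 - q ^+ T.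
    by rewrite -[in RHS](expr1n R T) subrXX; congr (_ * _);
       apply: eq_bigr => i _; rewrite expr1n mul1r.
  by rewrite gerBl exprn_ge0.
have h1 : 2 * d * (\sum_(i < T) q ^+ i) <= delta / 3.
  apply: (@le_trans _ _ (delta / 3 * ((1 - q) * \sum_(i < T) q ^+ i))); last first.
    by rewrite ler_piMr // divr_ge0 // ltW.
  rewrite [leRHS]mulrA; apply: ler_wpM2r.
    by apply: sumr_ge0 => i _; rewrite exprn_ge0.
  rewrite qE /d mulrA [leRHS]mulrA; apply: ler_wpM2r; last by nra.
  by rewrite invr_ge0 ltW.
have h2 : q ^+ T <= delta / 3.
  apply: (@le_trans _ _ (expR (- (1 - q)) ^+ T)).
    apply: lerXn2r; rewrite ?nnegrE ?expR_ge0 //.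
    by have := expR_ge1Dx (- (1 - q)); apply: le_trans; lra.
  have -> : delta / 3 = expR (- ln (3 / delta)).
    by rewrite expRN lnK ?posrE ?divr_gt0 // invf_div.
  rewrite -expRM_natl ler_expR mulrN lerN2.
  have l0 : 0 <= ln (3 / delta) by rewrite ln_ge0 // ler_pdivlMr //; lra.
  apply: (@le_trans _ _ ((ln (3 / delta) * (N + 1) ^+ 2) * (1 - q))); last first.
    by rewrite ler_wpM2r // ltW.
  rewrite -mulrA ler_peMr // qE mulrA ler_pdivlMr // mul1r.
  by rewrite !expr2; nra.
by lra.
Qed.

Lemma sampler_correct (R : realType) (G : sgraph) (k : nat) (delta : R)
    (start : prog G k unit) (s0 : coloring G k) :
  (1 <= max_degree G)%N -> (max_degree G + 2 <= k)%N -> 0 < delta < 1 ->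
  finds_proper R start ->
  let D := final_prob R (sampler start delta) s0 in
  \sum_(s | proper_coloring s) D s = 1 /\
  dTV D (uniform R (@proper_coloring G k)) <= delta.
Proof.
move=> deg1 degk delta01 startP.
have G2 := max_degree_gt0_card deg1; have G0 := ltnW G2.
pose delta1 : R := delta / (k * #|G| + 1)%:R ^+ 2.
pose T := `|Num.ceil (ln (3 / delta) * (k * #|G| + 2)%:R ^+ 2)|%N.
(* Some memory has positive probability after [start], and it is proper. *)
have [z0 _] : exists z0 : Omega G k, true.
  have [t /startP tP] : exists t, final_prob R start s0 t != 0.
    apply/existsP; apply: contraT; rewrite negb_exists => /forallP no.
    have := final_prob_sum R degk G0 start s0; rewrite big1 => [/eqP|t _].
      by rewrite eq_sym oner_eq0.
    by apply/eqP; move: (no t); rewrite negbK.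
  have tO : proper_coloring t || singly_flawed t by rewrite tP.
  by exists (exist _ t tO).
move=> D; have -> : D = final_prob R (attempts start (mixing_time G k delta1) T) s0.
  by [].
split; first exact: attempts_proper.
have [delta0 delta1'] := andP delta01.
apply: bigmax_le => [|S _]; first exact: ltW.
have dgt : 0 < delta1 by rewrite divr_gt0 // exprn_gt0 // ltr0n addn1.
apply: le_trans (attempts_error degk G0 startP
  (fun s => mixing_timeP degk G0 s dgt (leqnn _)) T s0 z0 S) _.
apply: error_bound => //.
  rewrite ler_nat.
  (* An edge exists, so there are at least 2 vertices and at least 3 colors. *)
  have : (3 * 2 <= k * #|G|)%N by apply: leq_mul => //; lia.
  lia.
have -> : (k * #|G| + 1)%:R + 1 = (k * #|G| + 2)%:R :> R.
  by rewrite natr1 -addnS.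
apply: le_trans (ceil_ge _) _; rewrite (le_trans (ler_norm _)) //.
by rewrite -intr_norm -abszE -pmulrn.
Qed.

(** * Operation counts *)

Section RunningTime.
Variables (G : sgraph) (k : nat).
Local Notation prog := (prog G k).

Definition runs_within A (p : prog A) (b : nat) : Prop :=
  forall s, (time p s <= b)%N.

Lemma runs_within_bind A B (p : prog A) (f : A -> prog B) b b' :
  runs_within p b -> (forall a, runs_within (f a) b') ->
  runs_within (bind p f) (b + b').
Proof.
move=> pb fb s; apply: leq_trans (leq_add (pb s) (leqnn b')).
elim: p s {pb} => /= [a|q IH|q IH|q IH|q IH|u v q IH|v q IH|v c q IH] s;
  rewrite ?addSn ?ltnS //; first exact: fb.
- by apply/bigmax_leqP => a _; apply: leq_trans (IH a s) _; rewrite leq_add2r;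
    apply: (leq_bigmax (F := fun a => time (q a) s) a).
- by apply/bigmax_leqP => a _; apply: leq_trans (IH a s) _; rewrite leq_add2r;
    apply: (leq_bigmax (F := fun a => time (q a) s) a).
- by apply/bigmax_leqP => a _; apply: leq_trans (IH a s) _; rewrite leq_add2r;
    apply: (leq_bigmax (F := fun a => time (q a) s) a).
Qed.

Lemma runs_within_le A (p : prog A) b b' :
  (b <= b')%N -> runs_within p b -> runs_within p b'.
Proof. by move=> bb' pb s; apply: leq_trans (pb s) bb'. Qed.

Lemma runs_within_compute A (a : A) : runs_within (compute G k a) 1.
Proof. by []. Qed.

Lemma runs_within_all_in A (test : A -> prog bool) r b :
  (forall x, runs_within (test x) b) ->
  runs_within (all_in test r) (size r * b.+1).
Proof.
move=> testb; elim: r => [|x r IH] s //=.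
rewrite mulSn addSn ltnS.
by apply: (runs_within_bind (testb x)) => -[].
Qed.

Lemma runs_within_first_in A (test : A -> prog bool) r b :
  (forall x, runs_within (test x) b) ->
  runs_within (first_in test r) (size r * b.+1).
Proof.
move=> testb; elim: r => [|x r IH] s //=.
rewrite mulSn addSn ltnS.
by apply: (runs_within_bind (testb x)) => -[].
Qed.

Lemma runs_within_repeat m (p : prog unit) b :
  runs_within p b -> runs_within (repeat m p) (m * b.+1).
Proof.
move=> pb; elim: m => [|m IH] s //=.
by rewrite mulSn addSn ltnS; apply: (runs_within_bind pb).
Qed.

Lemma runs_within_draws : [/\ runs_within (flip G k) 1,
  runs_within (draw_vertex G k) 1 & runs_within (draw_color G k) 1].
Proof. by split=> s /=; rewrite ltnS; apply/bigmax_leqP. Qed.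

Local Notation n := #|G|.

(** The 6 is one query, two reads and two evaluations, plus the loop tick. *)
Lemma runs_within_proper : runs_within (proper_prog G k) (n * (n * 6).+1).
Proof.
rewrite {1}cardE; apply: runs_within_all_in => u.
by rewrite cardE; apply: runs_within_all_in => v s.
Qed.

Lemma runs_within_flaw : runs_within (flaw_prog G k) (n * (n * (n * 6).+1).+1 + 1).
Proof.
apply: runs_within_bind => [|x]; last exact: runs_within_compute.
rewrite {1}cardE; apply: runs_within_first_in => x.
rewrite {1}cardE; apply: runs_within_all_in => u.
by rewrite cardE; apply: runs_within_all_in => v s.
Qed.

Lemma runs_within_step : (0 < n)%N ->
  runs_within (single_flaw_step G k) (22 * n ^ 3).
Proof.
move=> n0.
pose t := (n * (n * 6).+1 + (n * (n * (n * 6).+1).+1 + 1))%N.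
have inO : runs_within (in_Omega_prog G k) t.
  apply: runs_within_bind; first exact: runs_within_proper.
  by case=> [//|]; apply: runs_within_flaw.
(* In order: flip, vertex, color, read, write, test, restoring write. The total
   [6 n^3 + 7 n^2 + 2 n + 7] explains the 22. *)
apply: (@runs_within_le _ _ (1 + (1 + (1 + (1 + (1 + (t + 1))))))).
  have n2 : (n <= n * n)%N by rewrite leq_pmulr.
  have n3 : (n * n <= n * n * n)%N by rewrite leq_pmulr.
  by rewrite /t !expnS expn0; lia.
have [flip1 vertex1 color1] := runs_within_draws.
apply: (runs_within_bind flip1) => -[s //|].
apply: (runs_within_bind vertex1) => v.
apply: (runs_within_bind color1) => c.
apply: (runs_within_bind (p := read k v)) => [s //|old].
apply: (runs_within_bind (p := write v c)) => [s //|_].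
by apply: (runs_within_bind inO) => -[] s.
Qed.

(** The parameter [m] bounds the colored list throughout, so that the cost per vertex stays constant
    in the induction. *)
Lemma runs_within_greedy_from m colored todo :
  (size colored + size todo <= m)%N ->
  runs_within (greedy_from k colored todo) (size todo * (k * (m * 4).+1 + 2)).
Proof.
elim: todo colored => [|v todo IH] colored cm s; first by [].
rewrite /= in cm; pose p := let! oc := first_in (conflict_free v colored) (enum 'I_k) in
  do! (if oc is Some c then write v c else Ret tt) then
  greedy_from k (v :: colored) todo.
suff /(_ s) ps : runs_within p (k * (m * 4).+1 + (1 + size todo * (k * (m * 4).+1 + 2))).
  by rewrite -[time _ _]/((time p s).+1) /= mulSn; lia.
apply: runs_within_bind => [|oc].
  rewrite -[X in (X * _)%N](size_enum_ord k); apply: runs_within_first_in => c.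
  apply: (@runs_within_le _ _ (size colored * 4)); last first.
    by apply: runs_within_all_in => u s'.
  by rewrite leq_mul2r (leq_trans (leq_addr _ _) cm) orbT.
apply: runs_within_bind => [|_]; first by case: oc => [c|] s'.
by apply: IH; rewrite /= addSn -addnS.
Qed.

Lemma runs_within_greedy : runs_within (greedy G k) (n * (k * (n * 4).+1 + 2)).
Proof.
by rewrite [X in (X * _)%N]cardE; apply: runs_within_greedy_from; rewrite -cardE.
Qed.

Lemma runs_within_attempts (start : prog unit) tau T a b c :
  runs_within start a -> runs_within (single_flaw_step G k) b ->
  runs_within (proper_prog G k) c ->
  runs_within (attempts start tau T) (T * (a + tau * b.+1 + c).+1 + a).
Proof.
move=> sa sb sc; elim: T => [|T IH] s; first exact: sa.
set e := (T * _ + _)%N in IH.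
have -> : (T.+1 * (a + tau * b.+1 + c).+1 + a = (a + (tau * b.+1 + (c + e))).+1)%N.
  by rewrite /e mulSn; lia.
rewrite [time _ _]/= ltnS.
apply: (runs_within_bind sa) => _.
apply: (runs_within_bind (runs_within_repeat _ sb)) => _.
by apply: (runs_within_bind sc) => -[s' //|]; apply: IH.
Qed.

Lemma time_sampler_le (R : realType) (delta : R) s : (0 < n)%N ->
  (time (sampler (greedy G k) delta) s <=
    2 + (`|Num.ceil (ln (3 / delta) * (k * n + 2)%:R ^+ 2)|%N *
      (n * (k * (n * 4).+1 + 2) +
       mixing_time G k (delta / (k * n + 1)%:R ^+ 2) * (22 * n ^ 3).+1 +
       n * (n * 6).+1).+1 + n * (k * (n * 4).+1 + 2)))%N.
Proof.
move=> n0; rewrite !ltnS.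
by apply: runs_within_attempts;
  [exact: runs_within_greedy|exact: runs_within_step|exact: runs_within_proper].
Qed.

End RunningTime.

Lemma pathwidth_decomposition (G : sgraph) : exists2 bags : seq {set G},
  path_decomposition bags &
  {in bags, forall X : {set G}, (#|X| <= (pathwidth G).+1)%N}.
Proof.
have [|bags bagsP widthE] := @nat_minP (fun w =>
    exists2 bags : seq {set G}, path_decomposition bags & width bags = w).
  by exists (width [:: [set: G]]), [:: [set: G]] => //; apply: trivial_path_decomposition.
exists bags => // X Xb; rewrite /pathwidth -widthE; apply: leq_trans (leqSpred _).
exact: (leq_bigmax_seq (F := fun X : {set G} => #|X|)).
Qed.

(** * Reduction of all bounds to a single monomial *)

Section Monomials.
Variable R : realType.
Implicit Types x K c u M L sp y tau T : R.

Let exp_ge1 x m : 1 <= x -> 1 <= x ^+ m := @exprn_ege1 R m x.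

(** Here [x] stands for the number of vertices, [K] for [1 + eps], [M] and [L] for the factors of
    [relaxation_bound], [sp] for the power of [spread], and [u] for the power of [x] that absorbs
    the pathwidth. *)
Lemma relaxation_monomial_le x K c u M L sp :
  1 <= x -> 1 <= K -> 1 <= c -> 1 <= u ->
  0 <= M <= K * x ^+ 2 -> 0 <= L <= 2 * x ^+ 2 -> 0 <= sp <= c * u ->
  6 * M * (2 + M ^+ 2 * L ^+ 2 * sp) <= 36 * K ^+ 3 * c * x ^+ 10 * u.
Proof.
move=> x1 K1 c1 u1 /andP[M0 Mle] /andP[L0 Lle] /andP[sp0 sple].
have x0 : 0 <= x := le_trans ler01 x1; have K0 : 0 <= K := le_trans ler01 K1.
have c0 : 0 <= c := le_trans ler01 c1; have u0 : 0 <= u := le_trans ler01 u1.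
have h : M ^+ 2 * L ^+ 2 * sp <= (K * x ^+ 2) ^+ 2 * (2 * x ^+ 2) ^+ 2 * (c * u).
  rewrite ler_pM ?mulr_ge0 ?exprn_ge0 // ler_pM ?exprn_ge0 //;
    by rewrite lerXn2r // nnegrE mulr_ge0 ?exprn_ge0.
have h1 : 1 <= K ^+ 2 * c * x ^+ 8 * u.
  by rewrite !mulr_ege1 ?exp_ge1.
apply: (@le_trans _ _ (6 * (K * x ^+ 2) * (6 * (K ^+ 2 * c * x ^+ 8 * u)))).
  apply: ler_pM; rewrite ?mulr_ge0 ?addr_ge0 ?mulr_ge0 ?exprn_ge0 ?ler_pM2l //.
  have E : (K * x ^+ 2) ^+ 2 * (2 * x ^+ 2) ^+ 2 * (c * u) =
    4 * (K ^+ 2 * c * x ^+ 8 * u) by ring.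
  rewrite E in h; lra.
by rewrite le_eqVlt; apply/orP; left; apply/eqP; ring.
Qed.

(** Here [y] stands for [1 + ln delta^-1]. In the constant, 19 bounds the rounds, 288 the mixing
    time, 23 a step with its tick, 15 the remaining work of a round, and 9 the last greedy run with
    the two evaluations. *)
Lemma time_monomial_le x K c u y n k tau T :
  1 <= x -> 1 <= K -> 1 <= c -> 1 <= u -> 1 <= y ->
  n = x -> 0 <= k <= K * x ->
  0 <= tau <= 36 * K ^+ 3 * c * x ^+ 10 * u * (5 * (K * x ^+ 2) + 2 * (y - 1)) + 1 ->
  0 <= T <= (y + 1) * (k * n + 2) ^+ 2 + 1 ->
  2 + (T * (n * (k * (n * 4 + 1) + 2) + tau * (22 * n ^+ 3 + 1) + n * (n * 6 + 1) + 1)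
     + n * (k * (n * 4 + 1) + 2)) <=
  (9 + 19 * (15 + 288 * 23)) * K ^+ 6 * c * x ^+ 19 * u * y ^+ 2.
Proof.
move=> x1 K1 c1 u1 y1 -> /andP[k0 kK] /andP[tau0 tauB] /andP[T0 TB].
have x0 : 0 <= x := le_trans ler01 x1; have K0 : 0 <= K := le_trans ler01 K1.
have c0 : 0 <= c := le_trans ler01 c1; have u0 : 0 <= u := le_trans ler01 u1.
have y0 : 0 <= y := le_trans ler01 y1.
have x2 : 1 <= x ^+ 2 := exp_ge1 _ x1; have x3 : 1 <= x ^+ 3 := exp_ge1 _ x1.
have xx2 : x <= x ^+ 2 by rewrite expr2 ler_peMr.
have x23 : x ^+ 2 <= x ^+ 3 by rewrite (exprS x 2) ler_peMl ?exprn_ge0.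
have Kx2 : 1 <= K * x ^+ 2 by rewrite mulr_ege1.
have tau1 : tau <= 288 * (K ^+ 4 * c * x ^+ 12 * u * y).
  apply: le_trans tauB _; set B0 := K ^+ 3 * c * x ^+ 10 * u.
  have B1 : 1 <= B0 by rewrite /B0 !mulr_ege1 ?exp_ge1.
  have -> : 36 * K ^+ 3 * c * x ^+ 10 * u = 36 * B0 by rewrite /B0; ring.
  have -> : K ^+ 4 * c * x ^+ 12 * u * y = B0 * (K * x ^+ 2 * y) by rewrite /B0; ring.
  have h : 5 * (K * x ^+ 2) + 2 * (y - 1) + 1 <= 8 * (K * x ^+ 2 * y) by nra.
  nra.
have T1 : T <= 19 * (K ^+ 2 * x ^+ 4 * y).
  apply: le_trans TB _.
  have h : k * x + 2 <= 3 * (K * x ^+ 2).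
    have : k * x <= K * x * x by rewrite ler_wpM2r.
    rewrite -mulrA -expr2; lra.
  have h2 : (k * x + 2) ^+ 2 <= (3 * (K * x ^+ 2)) ^+ 2.
    by rewrite lerXn2r // nnegrE ?addr_ge0 ?mulr_ge0 //; lra.
  have E : (3 * (K * x ^+ 2)) ^+ 2 = 9 * (K ^+ 2 * x ^+ 4) by ring.
  have K2 : 1 <= K ^+ 2 * x ^+ 4 by rewrite mulr_ege1 ?exp_ge1.
  rewrite E in h2; have := sqr_ge0 (k * x + 2); nra.
have greedy_le : x * (k * (x * 4 + 1) + 2) <= 7 * (K * x ^+ 3).
  have h : k * (x * 4 + 1) <= K * x * (5 * x) by rewrite ler_pM //; lra.
  have E : x * (K * x * (5 * x)) = 5 * (K * x ^+ 3) by ring.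
  have h2 : x * (k * (x * 4 + 1)) <= x * (K * x * (5 * x)) by rewrite ler_wpM2l.
  have h3 : x ^+ 3 <= K * x ^+ 3 by rewrite ler_peMl // exprn_ge0.
  rewrite mulrDr; lra.
have proper_le : x * (x * 6 + 1) <= 7 * (K * x ^+ 3).
  have h3 : x ^+ 3 <= K * x ^+ 3 by rewrite ler_peMl // exprn_ge0.
  have E : x * (x * 6 + 1) = 6 * x ^+ 2 + x by ring.
  rewrite E; lra.
set Z := K ^+ 4 * c * x ^+ 15 * u * y.
have KZ : K * x ^+ 3 <= Z.
  have -> : Z = K * x ^+ 3 * (K ^+ 3 * c * x ^+ 12 * u * y) by rewrite /Z; ring.
  by rewrite ler_peMr ?mulr_ge0 ?exprn_ge0 // !mulr_ege1 ?exp_ge1.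
have Kx3 : 1 <= K * x ^+ 3 by rewrite mulr_ege1.
have step_le : tau * (22 * x ^+ 3 + 1) <= (288 * 23) * Z.
  have h : 22 * x ^+ 3 + 1 <= 23 * x ^+ 3 by lra.
  apply: (@le_trans _ _ (288 * (K ^+ 4 * c * x ^+ 12 * u * y) * (23 * x ^+ 3))).
    by rewrite ler_pM // addr_ge0 ?mulr_ge0 ?exprn_ge0.
  by rewrite /Z le_eqVlt; apply/orP; left; apply/eqP; ring.
set I := _ + _ + _ + 1.
have I0 : 0 <= I.
  by rewrite /I !addr_ge0 ?mulr_ge0 ?addr_ge0 ?mulr_ge0 ?addr_ge0 ?exprn_ge0 ?mulr_ge0.
have I_le : I <= (15 + 288 * 23) * Z by rewrite /I; lra.
set W := K ^+ 6 * c * x ^+ 19 * u * y ^+ 2.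
have ZW : Z <= W.
  have -> : W = Z * (K ^+ 2 * x ^+ 4 * y) by rewrite /W /Z; ring.
  rewrite ler_peMr // ?mulr_ge0 ?exprn_ge0 //.
  by rewrite !mulr_ege1 ?exp_ge1.
have TI : T * I <= (19 * (15 + 288 * 23)) * W.
  apply: (@le_trans _ _ (19 * (K ^+ 2 * x ^+ 4 * y) * ((15 + 288 * 23) * Z))).
    by rewrite ler_pM.
  by rewrite /W /Z le_eqVlt; apply/orP; left; apply/eqP; ring.
have -> : (9 + 19 * (15 + 288 * 23)) * K ^+ 6 * c * x ^+ 19 * u * y ^+ 2 =
    (9 + 19 * (15 + 288 * 23)) * W by rewrite /W; ring.
lra.
Qed.

End Monomials.

(** With [k - D = eps * D] at least 2, subtracting one loses at most a factor 2. *)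
Lemma spread_le (R : realType) (G : sgraph) (k : nat) (eps : R) :
  0 < eps -> (1 <= max_degree G)%N -> (max_degree G + 2 <= k)%N ->
  k%:R = (1 + eps) * (max_degree G)%:R ->
  spread R G k <= 2 * ((1 + eps) / eps) ^+ 2.
Proof.
move=> eps0 deg1 degk kE; set D := max_degree G in deg1 degk kE *.
have D0 : 0 < D%:R :> R by rewrite ltr0n.
have kD : (k - D)%:R = eps * D%:R by rewrite natrB ?kE; [ring|lia].
have m2 : eps * D%:R / 2 <= (k - D).-1%:R.
  rewrite -kD ler_pdivrMr // -natrM ler_nat; lia.
have kD0 : 0 < (k - D)%:R :> R by rewrite ltr0n; lia.
rewrite /spread -/D ler_pdivrMr ?mulr_gt0 //; last by rewrite ltr0n; lia.
apply: (@le_trans _ _ (2 * ((1 + eps) / eps) ^+ 2 * ((k - D)%:R * (eps * D%:R / 2)))).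
  by rewrite kD kE le_eqVlt; apply/orP; left; apply/eqP; field; rewrite gt_eqF.
apply: ler_wpM2l; first by rewrite mulr_ge0 ?sqr_ge0.
by apply: ler_wpM2l => //; apply: ltW.
Qed.

(** The exchange [c ^ (C ln n) = n ^ (C ln c)], through which logarithmic pathwidth becomes a
    polynomial. *)
Lemma expr_log_le (R : realType) (c C : R) (n w : nat) : 1 <= c ->
  (0 < n)%N -> w%:R <= C * ln n%:R ->
  c ^+ w <= n%:R ^+ `|Num.ceil (C * ln c)|%N.
Proof.
move=> c1 n0 wC; have c0 : 0 < c := lt_le_trans ltr01 c1.
have n0' : 0 < n%:R :> R by rewrite ltr0n.
rewrite -[in leLHS](lnK (x := c)) ?posrE // -[in leRHS](lnK (x := n%:R)) ?posrE //.
rewrite -!expRM_natl ler_expR.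
apply: (@le_trans _ _ (C * ln n%:R * ln c)).
  by rewrite ler_wpM2r // ln_ge0.
rewrite mulrAC; apply: ler_wpM2r; first by rewrite ln_ge0 // ler1n.
apply: le_trans (ceil_ge _) _; rewrite (le_trans (ler_norm _)) //.
by rewrite -intr_norm -abszE -pmulrn.
Qed.

Lemma ln_card_Omega_le (R : realType) (G : sgraph) (k : nat) : (0 < k)%N ->
  ln #|{: Omega G k}|%:R <= (#|G| * k)%:R :> R.
Proof.
move=> k0.
have le_kn : (#|{: Omega G k}| <= k ^ #|G|)%N.
  apply: leq_trans (leq_card val val_inj) _.
  by rewrite card_ffun card_ord.
have [E|O0] := posnP #|{: Omega G k}|; first by rewrite E ln0.
apply: (@le_trans _ _ (ln (k%:R ^+ #|G|))).
  by rewrite ler_ln ?posrE ?exprn_gt0 ?ltr0n // -natrX ler_nat.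
rewrite lnXn ?ltr0n // natrM mulr_natl lerMn2r.
by rewrite ltW ?orbT // ln_sublinear // ltr0n.
Qed.

Lemma ln_failure_le (R : realType) (N : nat) (delta : R) : 0 < delta ->
  ln (delta / (N + 1)%:R ^+ 2)^-1 <= 2 * N%:R + ln delta^-1.
Proof.
move=> delta0; have N0 : 0 < (N + 1)%:R :> R by rewrite ltr0n addn1.
rewrite invf_div ln_div ?posrE ?exprn_gt0 // lnXn // lnV ?posrE // lerD2r.
rewrite -(mulr_natl (ln _)) ler_wpM2l // natrD addrC le_ln1Dx //.
by apply: lt_le_trans (ler0n _ _); rewrite ltrN10.
Qed.

Lemma log_terms_le (R : realType) (G : sgraph) (k : nat) (delta : R) :
  (0 < k)%N -> 0 < delta ->
  ln #|{: Omega G k}|%:R + 2 * ln (delta / (k * #|G| + 1)%:R ^+ 2)^-1 <=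
  5 * (#|G| * k)%:R + 2 * ln delta^-1.
Proof.
move=> k0 delta0; have h1 := ln_card_Omega_le R G k0.
have := ln_failure_le (k * #|G|) delta0; rewrite [(k * _)%N]mulnC => h2; lra.
Qed.

Lemma ln3_le2 (R : realType) : ln 3 <= 2 :> R.
Proof.
have -> : 3 = 1 + 2 :> R by rewrite -(natrD R 1 2).
by apply: le_ln1Dx; apply: lt_trans (ltr0n _ 2); rewrite ltrN10.
Qed.

Lemma sampler_time_le (R : realType) (eps C : R) : 0 < eps -> 0 < C ->
  exists p : {poly {poly R}},
  forall (G : sgraph) (k : nat) (delta : R) (s0 : coloring G k),
    (1 <= max_degree G)%N ->
    (max_degree G + 2 <= k)%N ->
    k%:R = (1 + eps) * (max_degree G)%:R ->
    0 < delta < 1 ->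
    (pathwidth G)%:R <= C * ln #|G|%:R ->
    (time (sampler (greedy G k) delta) s0)%:R
      <= p.[#|G|%:R, ln delta^-1].
Proof.
move=> eps0 C0; pose K := 1 + eps; pose c := 2 * ((1 + eps) / eps) ^+ 2.
pose a := `|Num.ceil (C * ln c)|%N.
pose A := (9 + 19 * (15 + 288 * 23)) * K ^+ 6 * c.
(* The outer variable is the number of vertices, the inner one [ln delta^-1]; [A] and [a] depend on
   [eps] and [C] only. *)
exists ((A%:P * (1%:P + 'X) ^+ 2)%:P * 'X^((19 + a)%N)) => G k delta s0 deg1 degk kE delta01 pwC.
have [delta0 delta1] := andP delta01.
have n2 := max_degree_gt0_card deg1; have n0 := ltnW n2.
set n := #|G| in n2 n0 *; set l := ln delta^-1.
have l0 : 0 <= l by rewrite ln_ge0 // invf_ge1 // ltW.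
have n1 : 1 <= n%:R :> R by rewrite ler1n.
have K1 : 1 <= K by rewrite lerDl ltW.
have c1 : 1 <= c.
  have : 1 <= ((1 + eps) / eps) ^+ 2 by rewrite exprn_ege1 // ler_pdivlMr // mul1r lerDr.
  by rewrite /c; lra.
have u1 : 1 <= n%:R ^+ a :> R by rewrite exprn_ege1.
have kK : k%:R <= K * n%:R.
  rewrite kE ler_wpM2l ?(le_trans ler01) // ler_nat ltnW //.
  exact: max_degree_lt_card.
have pE : (((A%:P * (1%:P + 'X) ^+ 2)%:P * 'X^((19 + a)%N)) : {poly {poly R}}).[n%:R, l] =
    (9 + 19 * (15 + 288 * 23)) * K ^+ 6 * c * n%:R ^+ 19 * n%:R ^+ a * (1 + l) ^+ 2.
  rewrite hornerM hornerC hornerXn hornerM horner_exp hornerM horner_exp hornerD.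
  rewrite !hornerC hornerX.
  by rewrite exprD mulrAC; congr (_ * _); apply: mulrA.
rewrite {}pE.
have := time_sampler_le delta s0 n0; rewrite -(ler_nat R) => ts; apply: le_trans ts _.
have [bags bagsP bagsb] := pathwidth_decomposition G.
have N1 : 1 <= (k * n + 1)%:R :> R by rewrite ler1n addn1.
have N0 : 0 < (k * n + 1)%:R ^+ 2 :> R by rewrite exprn_gt0 // (lt_le_trans ltr01).
have d0 : 0 < delta / (k * n + 1)%:R ^+ 2 by rewrite divr_gt0.
have d1 : delta / (k * n + 1)%:R ^+ 2 <= 1.
  by rewrite ler_pdivrMr // mul1r (le_trans (ltW delta1)) // exprn_ege1.
have := mixing_time_le degk n0 bagsP bagsb (introT andP (conj d0 d1)).
set tau := mixing_time _ _ _ => tauB.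
set X := ln (3 / delta) * _; set T := `|Num.ceil X|%N.
have nk : (n * k)%:R <= K * n%:R ^+ 2 by rewrite natrM expr2 mulrCA ler_wpM2l.
have sp0 : 0 <= spread R G k by rewrite (le_trans ler01) // spread_ge1.
have sp : 0 <= spread R G k ^+ (pathwidth G).+1 <= c * n%:R ^+ a.
  rewrite exprn_ge0 //=; apply: (@le_trans _ _ (c ^+ (pathwidth G).+1)).
    rewrite lerXn2r ?nnegrE ?(le_trans ler01 c1) //.
    exact: spread_le.
  (* Bags have up to [pathwidth G + 1] vertices; the extra one costs a single factor [c]. *)
  rewrite exprS ler_wpM2l ?(le_trans ler01) //.
  exact: expr_log_le.
have L_le : (n * n.+1)%:R <= 2 * n%:R ^+ 2 :> R.
  by rewrite -natrX -natrM ler_nat mulnS mul2n -addnn leq_add2r leq_pmulr.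
have tau_le : tau%:R <= 36 * K ^+ 3 * c * n%:R ^+ 10 * n%:R ^+ a *
    (5 * (K * n%:R ^+ 2) + 2 * (1 + l - 1)) + 1.
  apply: le_trans tauB _; rewrite lerD2r; apply: ler_pM.
  - by rewrite (le_trans ler01) // relaxation_bound_ge1.
  - by rewrite addr_ge0 ?ln_nat_ge0 // mulr_ge0 // ln_ge0 // invf_ge1.
  - by apply: relaxation_monomial_le; rewrite ?ler0n.
  have k0 : (0 < k)%N by apply: leq_trans degk; rewrite addn2.
  apply: le_trans (log_terms_le G k0 delta0) _.
  by rewrite [1 + l]addrC addrK lerD2r ler_wpM2l.
have X0 : 0 <= X.
  rewrite mulr_ge0 ?exprn_ge0 // ln_ge0 // ler_pdivlMr // mul1r.
  by rewrite (le_trans (ltW delta1)) // ler1n.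
have cX : 0 <= Num.ceil X by rewrite ceil_ge0; apply: lt_le_trans X0; rewrite ltrN10.
have T_le : T%:R <= (1 + l + 1) * (k%:R * n%:R + 2) ^+ 2 + 1.
  have -> : T%:R = (Num.ceil X)%:~R :> R by rewrite -[in RHS](gez0_abs cX).
  have h : (Num.ceil X)%:~R <= X + 1.
    by have := ceilB1_lt X; rewrite intrB ltrBlDr => /ltW.
  apply: le_trans h _; rewrite lerD2r /X natrD natrM.
  apply: ler_wpM2r; first by rewrite exprn_ge0 // addr_ge0 ?mulr_ge0.
  rewrite lnM ?posrE ?invr_gt0 // -/l.
  by rewrite addrAC lerD2r; apply: ln3_le2.
have y1 : 1 <= 1 + l by rewrite lerDl.
apply: le_trans (time_monomial_le n1 K1 c1 u1 y1 erefl
  (introT andP (conj (ler0n _ _) kK)) (introT andP (conj (ler0n _ _) tau_le))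
  (introT andP (conj (ler0n _ _) T_le))).
by rewrite !(natrD, natrM, natrX, =^~ natr1).
Qed.

Theorem theorem4p1 (R : realType) :
  (forall (G : sgraph) (k : nat) (delta : R) (start : prog G k unit)
      (s0 : coloring G k),
    (1 <= max_degree G)%N ->
    (max_degree G + 2 <= k)%N ->
    0 < delta < 1 ->
    finds_proper R start ->
    let D := final_prob R (sampler start delta) s0 in
    \sum_(s | proper_coloring s) D s = 1 /\
    dTV D (uniform R (@proper_coloring G k)) <= delta)
  /\
  (forall eps C : R, 0 < eps -> 0 < C ->
    exists p : {poly {poly R}},
    forall (G : sgraph) (k : nat) (delta : R) (s0 : coloring G k),
      (1 <= max_degree G)%N ->
      (max_degree G + 2 <= k)%N ->
      k%:R = (1 + eps) * (max_degree G)%:R ->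
      0 < delta < 1 ->
      (pathwidth G)%:R <= C * ln #|G|%:R ->
      (time (sampler (greedy G k) delta) s0)%:R
        <= p.[#|G|%:R, ln delta^-1]).
Proof.
split=> [G k delta start s0 deg1 degk delta01 startP|eps C eps0 C0].
  exact: sampler_correct.
exact: sampler_time_le.
Qed.
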